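(* Let $W:H\to H$ be a unitary operator. The point spectrum of the selfadjoint extension $L_W$ of $L_0$ is empty, i.e. $$\sigma_p(L_W)=\emptyset.$$
   Context: Setting. $H\neq\{0\}$ is a separable complex Hilbert space (inner products are linear in the first argument), $a<b$ are real numbers, and $A:D(A)\subset H\to H$ is a linear selfadjoint (possibly unbounded) operator. Put $L^2:=L^2(H,(-\infty,a))\oplus L^2(H,(b,+\infty))$ (direct sum of spaces of square-integrable $H$-valued functions). Let $H_+=D(A)$ with inner product $(f,g)_+=(Af,Ag)_H+(f,g)_H$, let $H_-$ be the corresponding negative-norm space (the dual of $H_+$ with respect to $H$), and let $\tilde A:H\to H_-$ be the continuous extension of $A$ (the adjoint of the continuous operator $A:H_+\to H$). Consider the differential expression $$\tilde l(u)=(\tilde l_1(u_1),\tilde l_2(u_2))=(iu_1'+\tilde A u_1,\ iu_2'+\tilde A u_2),\quad u=(u_1,u_2).$$ Minimal and maximal operators. On $I_1=(-\infty,a)$ and $I_2=(b,+\infty)$ let $\mathcal T_k$ be the set of finite sums of functions $\varphi(t)f$ with $\varphi\in C_0^\infty(I_k)$, $f\in D(A)$. The minimal operator $L_{k0}$ is the closure in $L^2(H,I_k)$ of the operator $\phi\mapsto i\phi'+A\phi$ on $\mathcal T_k$. The maximal operator is $L_k=L_{k0}^*$: $u\in D(L_k)$ with $L_ku=g$ iff $u,g\in L^2(H,I_k)$ and $\int_{I_k}(u,i\phi'+A\phi)_H\,dt=\int_{I_k}(g,\phi)_H\,dt$ for all $\phi\in\mathcal T_k$ (i.e. $i u'+\tilde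 A u=g$ in the weak sense). Set $L_0=L_{10}\oplus L_{20}$ and $L=L_1\oplus L_2$ in $L^2$; $L_0$ is closed symmetric and $L_0^*=L$. Each $u=(u_1,u_2)\in D(L)$ has a representative with $u_1$ continuous from $(-\infty,a]$ to $H$ and $u_2$ continuous from $[b,+\infty)$ to $H$; $u_1(a)$ and $u_2(b)$ denote the values of this representative. For a unitary operator $W:H\to H$, $L_W$ is the restriction of $L$ to $D(L_W)=\{u=(u_1,u_2)\in D(L):\ u_2(b)=Wu_1(a)\}$; it is a selfadjoint extension of $L_0$ in $L^2$. $\sigma_p$ denotes the point spectrum (set of eigenvalues). *)

(* Defs.v *)
From HB Require Import structures.
From mathcomp Require Import all_boot all_order all_algebra.
From mathcomp Require Import all_classical all_reals all_analysis.
From mathcomp Require Import complex.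
Set Implicit Arguments.
Unset Strict Implicit.
Unset Printing Implicit Defensive.
Import Order.TTheory GRing.Theory Num.Theory.
Import numFieldNormedType.Exports.
Local Open Scope classical_set_scope.
Local Open Scope ring_scope.

(* An unbounded operator is handled through its graph.  The vectors of the
   ambient space are the elements of [S]; [V] may be larger, since the elements
   of L^2(H, I) are represented by functions R -> H, see [L2] below. *)
Definition adjoint_graph {K V : Type} (S : set V) (ip : V -> V -> K)
    (G : set (V * V)) : set (V * V) :=
  [set p | [/\ S p.1, S p.2 & forall q, G q -> ip p.1 q.2 = ip p.2 q.1]].

Definition directsum_graph {V1 V2 : Type} (G1 : set (V1 * V1))
    (G2 : set (V2 * V2)) : set ((V1 * V2) * (V1 * V2)) :=
  [set p | G1 (p.1.1, p.2.1) /\ G2 (p.1.2, p.2.2)].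

(* [null] is the set of representatives of the zero vector. *)
Definition point_spectrum {K : pzRingType} {V : lmodType K} (null : set V)
    (G : set (V * V)) : set K :=
  [set z | exists u : V, ~ null u /\ G (u, z *: u)].

Section hilbert.
Context {R : realType} {H : completeNormedModType R[i]}.
Variable dot : {dot H for Num.conj}.

(* The values of [A] outside the domain [D] are irrelevant. *)
Definition linear_on (D : set H) (A : H -> H) : Prop :=
  D 0 /\ forall (z : R[i]) (x y : H), D x -> D y ->
    D (z *: x + y) /\ A (z *: x + y) = z *: A x + A y.

Definition op_graph (D : set H) (A : H -> H) : set (H * H) :=
  [set p | D p.1 /\ p.2 = A p.1].

Definition selfadjoint (D : set H) (A : H -> H) : Prop :=
  dense D /\ adjoint_graph setT dot (op_graph D A) = op_graph D A.

Definition unitary (W : H -> H) : Prop :=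
  (forall x y, dot (W x) (W y) = dot x y) /\ forall y, exists x, W x = y.

Local Notation mu := (@lebesgue_measure R).

(* Square of the norm of L^2(H, I). *)
Definition L2sqn (I : set R) (u : R -> H) : \bar R :=
  (\int[mu]_(t in I) (complex.Re `|u t| ^+ 2)%:E)%E.

(* Square-integrable functions on [I], Borel measurable for the norm topology
   of [H] (for separable [H] this is strong measurability).  Only the values
   on [I] matter, and functions equal a.e. on [I] represent the same vector. *)
Definition L2 (I : set R) : set (R -> H) :=
  [set u | measurable_fun I (u : R -> g_sigma_algebraType (@open H)) /\
           (L2sqn I u < +oo)%E].

Definition L2dot (I : set R) (u v : R -> H) : R[i] :=
  Complex (\int[mu]_(t in I) complex.Re (dot (u t) (v t)))%R
          (\int[mu]_(t in I) complex.Im (dot (u t) (v t)))%R.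

Definition L2closure (I : set R) (G : set ((R -> H) * (R -> H))) :
    set ((R -> H) * (R -> H)) :=
  [set p | [/\ L2 I p.1, L2 I p.2 & forall e : R, 0 < e ->
     exists q, [/\ G q, (L2sqn I (p.1 - q.1)%R < e%:E)%E
                      & (L2sqn I (p.2 - q.2)%R < e%:E)%E]]].

Definition smooth (g : R -> R) : Prop :=
  forall (n : nat) (t : R), derivable (derive1n n g) t 1.

(* C_0^\infty(I), functions being extended by 0 outside [I]. *)
Definition test_function (I : set R) (phi : R -> R[i]) : Prop :=
  [/\ smooth (fun t => complex.Re (phi t)),
      smooth (fun t => complex.Im (phi t)),
      compact (closure [set t | phi t != 0])
    & closure [set t | phi t != 0] `<=` I].

Definition cderive1 (phi : R -> R[i]) (t : R) : R[i] :=
  Complex (derive1 (fun s => complex.Re (phi s)) t)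
          (derive1 (fun s => complex.Im (phi s)) t).

Section operators.
Variables (D : set H) (A : H -> H).

(* Graph of phi |-> i phi' + A phi on the finite sums
   phi = \sum_j phi_j f_j, for which phi' = \sum_j phi_j' f_j. *)
Definition core_graph (I : set R) : set ((R -> H) * (R -> H)) :=
  [set p | exists (n : nat) (phi : 'I_n -> R -> R[i]) (f : 'I_n -> H),
    [/\ forall j, test_function I (phi j),
        forall j, D (f j),
        p.1 = (fun t => \sum_(j < n) phi j t *: f j)
      & p.2 = (fun t => (Complex 0 1) *: (\sum_(j < n) cderive1 (phi j) t *: f j)
                        + A (\sum_(j < n) phi j t *: f j))]].

Definition Lmin (I : set R) := L2closure I (core_graph I).

Definition Lmax (I : set R) := adjoint_graph (L2 I) (L2dot I) (Lmin I).

(* [v] is a representative of the class of [u] in L^2(H, I) that is continuous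
   on [J], the interval [I] together with its finite endpoint. *)
Definition continuous_rep (I J : set R) (u v : R -> H) : Prop :=
  {within J, continuous v} /\ ae_eq mu I u v.

Variables (a b : R).
Local Notation I1 := `]-oo, a[%classic.
Local Notation I2 := `]b, +oo[%classic.
Local Notation J1 := `]-oo, a]%classic.
Local Notation J2 := `[b, +oo[%classic.

(* The zero vector of L^2(H, I1) (+) L^2(H, I2). *)
Definition L2null : set ((R -> H) * (R -> H)) :=
  [set u | ae_eq mu I1 u.1 (fun=> 0) /\ ae_eq mu I2 u.2 (fun=> 0)].

(* Continuous representatives are unique on [J1] and [J2], so [v1 a] and
   [v2 b] are the boundary values u_1(a) and u_2(b). *)
Definition L_W (W : H -> H) :
    set (((R -> H) * (R -> H)) * ((R -> H) * (R -> H))) :=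
  [set p | directsum_graph (Lmax I1) (Lmax I2) p /\
    exists v1 v2 : R -> H,
      [/\ continuous_rep I1 J1 p.1.1 v1, continuous_rep I2 J2 p.1.2 v2
        & v2 b = W (v1 a)]].

End operators.
End hilbert.

(* Main.v *)
Require Import Defs.
From HB Require Import structures.
From mathcomp Require Import all_boot all_order all_algebra.
From mathcomp Require Import all_classical all_reals all_analysis.
From mathcomp Require Import complex measurable_realfun ring lra.
Set Implicit Arguments.
Unset Strict Implicit.
Unset Printing Implicit Defensive.
Import Order.TTheory GRing.Theory Num.Theory.
Import numFieldNormedType.Exports.
Local Open Scope classical_set_scope.
Local Open Scope ring_scope.

(** If [i u' + A u = z u] then formally [u(t) = e^{-izt} e^{iAt} u_0], so
    [|u(t)|] is a multiple of [e^{t Im z}] and cannot be square integrable on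
    both half-lines: it vanishes on [(-oo, a)] when [Im z <= 0] and on
    [(b, +oo)] when [Im z >= 0], and the boundary condition carries the zero
    over to the other half-line.

    Instead of the unitary group we use [y = (A - i)^-1 u], which takes its
    values in [D(A)].  Since [(y, g) = (u, (A + i)^-1 g)] and [(A + i)^-1 g]
    lies in [D(A)], the weak equation tested against scalar bumps times
    [(A + i)^-1 g] shows that [(y, g)] is C^1, with derivative [(dy, g)] where
    [dy = i A y - i z y].  Symmetry of [A] gives [(|y|^2)' = 2 Im z |y|^2],
    and [|y| <= |u|]. *)

(** * Smooth test functions *)

Section smooth_functions.
Context {R : realType}.
Implicit Types (f g : R -> R) (p : {poly R}) (n : nat).

(** The eigenvalue equation is known only through tests against scalar bumps times vectors of [D],
    and [A] cannot be applied to the values of [u]. The resolvent removes the obstacle: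
    [i A (A - i)^-1] is defined and continuous on all of [H], so pairing with one fixed vector
    leaves a weak equation between two continuous scalar functions, for which the du Bois-Reymond
    lemma is enough. The price is twofold: [A - i] and [A + i] must be shown onto, which follows
    from selfadjointness by orthogonal projection, and smooth bumps must be built, here from
    [exp (- 1 / x)].

    The differential equation for |y|^2 holds on the open half-line only; continuity of the
    representative extends the resulting exponential law to the endpoint. Since the law is an
    equality, a zero at the endpoint spreads over the half-line whatever the sign of Im z, and
    injectivity of the resolvent carries it from [y] back to [u]. *)

Fixpoint Ck n f : Prop :=
  if n is n'.+1 then (forall t, derivable f t 1) /\ Ck n' (derive1 f) else True.

(** [Ck] takes the first derivative off at the front, so the product and chain rules lead back to
    functions known to one order less and closure properties go by induction. *)
Lemma smoothP f : smooth f <-> forall n, Ck n f.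
Proof.
split=> [sf n|].
  elim: n f sf => //= n IH f sf; split; first exact: (sf 0).
  by apply: IH => m t; rewrite -derive1Sn; exact: sf.
move=> Cf n; elim: n f Cf => [|n IH] f Cf t; first exact: (Cf 1).1.
by rewrite derive1Sn; apply: IH => m; exact: (Cf m.+1).2.
Qed.

Lemma CkW n f : Ck n.+1 f -> Ck n f.
Proof. by elim: n f => //= n IH f [df /IH]. Qed.

Lemma CkD n f g : Ck n f -> Ck n g -> Ck n (f \+ g).
Proof.
elim: n f g => //= n IH f g [df Cf] [dg Cg]; split.
  by move=> t; exact: derivableD.
rewrite (_ : derive1 (f \+ g) = derive1 f \+ derive1 g); first exact: IH.
by apply/funext => t; rewrite /= !derive1E deriveD.
Qed.

Lemma CkN n f : Ck n f -> Ck n (\- f).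
Proof.
elim: n f => //= n IH f [df Cf]; split.
  by move=> t; exact: derivableN.
rewrite (_ : derive1 (\- f) = \- derive1 f); first exact: IH.
by apply/funext => t; rewrite /= !derive1E deriveN.
Qed.

Lemma CkM n f g : Ck n f -> Ck n g -> Ck n (f \* g).
Proof.
elim: n f g => //= n IH f g [df Cf] [dg Cg]; split.
  by move=> t; exact: derivableM.
rewrite (_ : derive1 (f \* g) = (f \* derive1 g) \+ (g \* derive1 f)).
  by apply: CkD; apply: IH => //; exact: CkW.
by apply/funext => t; rewrite /= !derive1E deriveM.
Qed.

Lemma Ck_comp n f g : Ck n f -> Ck n g -> Ck n (f \o g).
Proof.
elim: n f g => //= n IH f g [df Cf] [dg Cg]; split.
  move=> t; apply/derivable1_diffP; apply: differentiable_comp.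
    exact/derivable1_diffP.
  exact/derivable1_diffP.
rewrite (_ : derive1 (f \o g) = (derive1 f \o g) \* derive1 g).
  by apply: CkM => //; apply: IH => //; exact: CkW.
by apply/funext => t; rewrite derive1_comp.
Qed.

Lemma Ck_cst n (c : R) : Ck n (cst c).
Proof.
elim: n c => //= n IH c; split; first by move=> t; exact: derivable_cst.
rewrite (_ : derive1 (cst c) = cst 0)//; apply/funext => t.
by rewrite derive1_cst.
Qed.

Lemma smooth_cst (c : R) : smooth (cst c).
Proof. by apply/smoothP => n; exact: Ck_cst. Qed.

Lemma Ck_id n : Ck n (@id R).
Proof.
case: n => //= n; split; first by move=> t; exact: derivable_id.
rewrite (_ : derive1 (@id R) = cst 1); first exact: Ck_cst.
by apply/funext => t; rewrite derive1_id.
Qed.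

Lemma smoothB f g : smooth f -> smooth g -> smooth (f \- g).
Proof.
move=> /smoothP Cf /smoothP Cg; apply/smoothP => n.
by apply: CkD => //; exact: CkN.
Qed.

Lemma smooth_comp f g : smooth f -> smooth g -> smooth (f \o g).
Proof.
by move=> /smoothP Cf /smoothP Cg; apply/smoothP => n; exact: Ck_comp.
Qed.

Lemma smooth_reflect (c : R) : smooth (fun x => c - x).
Proof.
apply/smoothP => n; apply: (@CkD n (cst c) (-%R)); first exact: Ck_cst.
by apply: CkN; exact: Ck_id.
Qed.

Lemma smooth_derive1 f : smooth f -> smooth (derive1 f).
Proof. by move=> sf n t; rewrite -derive1Sn; exact: sf. Qed.

Lemma smooth_derivable f t : smooth f -> derivable f t 1.
Proof. by move=> sf; exact: (sf 0). Qed.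

Lemma smooth_continuous f : smooth f -> continuous f.
Proof.
move=> sf t; apply: differentiable_continuous.
exact/derivable1_diffP/smooth_derivable.
Qed.

(* All derivatives of [flat 1], the function [exp (- 1 / x)], have this shape. *)
Definition flat p (x : R) : R :=
  if 0 < x then p.[x^-1] * expR (- x^-1) else 0.

Lemma exprn_le_fact_expR n (y : R) : 0 <= y -> y ^+ n <= n`!%:R * expR y.
Proof.
move=> y0; case: n => [|n].
  by rewrite expr0 fact0 mul1r; apply: le_trans (expR_ge1Dx _); rewrite lerDl.
have := expR_ge1Dxn n y0 => /(le_trans _); move=> /(_ (y ^+ n.+1 / n.+1`!%:R)).
rewrite lerDr => /(_ ler01); rewrite ler_pdivrMr ?ltr0n ?fact_gt0//.
by rewrite mulrC.
Qed.

Lemma horner_expRN_bounded p :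
  exists C, forall y, 0 <= y -> `|p.[y] * expR (- y)| <= C.
Proof.
exists (\sum_(i < size p) `|p`_i| * i`!%:R) => y y0.
rewrite horner_coef normrM (ger0_norm (expR_ge0 _)) expRN ler_pdivrMr ?expR_gt0//.
apply: le_trans (ler_norm_sum _ _ _) _; rewrite mulr_suml ler_sum// => i _.
rewrite normrM -mulrA ler_wpM2l// ger0_norm ?exprn_ge0//.
exact: exprn_le_fact_expR.
Qed.

(** With y = 1/x, boundedness of p(y) y^2 exp(-y) is exactly decay of order x^2. This makes the
    difference quotient of [flat p] at 0 tend to 0. *)
Lemma flat_le_sqr p : exists2 C, 0 <= C & forall x, `|flat p x| <= C * x ^+ 2.
Proof.
have [C HC] := horner_expRN_bounded (p * 'X^2).
have C0 : 0 <= C by exact: le_trans (HC 0 (lexx _)).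
exists C => // x; rewrite /flat; case: ifPn => x0; last first.
  by rewrite normr0 mulr_ge0// sqr_ge0.
have := HC _ (ltW (etrans (invr_gt0 _) x0)).
rewrite hornerM hornerXn mulrAC normrM [`|_ ^+ 2|]ger0_norm ?sqr_ge0//.
by rewrite exprVn ler_pdivrMr// exprn_gt0.
Qed.

(** With y = 1/x one has dy/dx = - y^2, so p(y) exp(-y) has derivative (p(y) - p'(y)) y^2 exp(-y).
    The family is thus closed under differentiation, whence smoothness. *)
Lemma is_derive_flat p (x : R) :
  is_derive x 1 (flat p) (flat ((p - p^`()) * 'X^2) x).
Proof.
have [x0|x0|->] := ltgtP x 0.
- rewrite {2}/flat ltNge (ltW x0)/=.
  apply: (near_eq_is_derive _ (is_derive_cst (0 : R) x 1)).
  near=> y; rewrite /flat ifF//; apply/negbTE; rewrite -leNgt ltW//.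
  near: y; exact: lt_nbhsl.
- rewrite {2}/flat x0.
  have xn0 : x != 0 by rewrite gt_eqF.
  suff : is_derive x 1 (fun y : R => p.[y^-1] * expR (- y^-1))
           (((p - p^`()) * 'X^2).[x^-1] * expR (- x^-1)).
    apply: near_eq_is_derive.
    near=> y; rewrite /flat ifT//.
    near: y; exact: lt_nbhsr.
  have dV : is_derive x 1 (fun y : R => y^-1) (- x^-1 ^+ 2).
    apply: is_derive_eq; first exact: (is_deriveV xn0).
    by rewrite scaler1 exprVn.
  have dp : is_derive x 1 (fun y : R => p.[y^-1]) (p^`().[x^-1] * - x^-1 ^+ 2).
    exact: (@is_derive1_comp _ (horner p) (fun y => y^-1)).
  have de : is_derive x 1 (fun y : R => expR (- y^-1))
       (x^-1 ^+ 2 * expR (- x^-1)).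
    have dN : is_derive x 1 (fun y : R => - y^-1) (x^-1 ^+ 2).
      by have := is_deriveN dV; rewrite opprK.
    rewrite mulrC; exact: (@is_derive1_comp _ expR (fun y => - y^-1)).
  have := is_deriveM dp de; rewrite /GRing.scale/=.
  set d1 := (X in is_derive _ _ _ X); set d2 := (X in _ -> is_derive _ _ _ X).
  suff -> : d1 = d2 by [].
  rewrite /d1 /d2 hornerM hornerXn hornerD hornerN; ring.
- have [C C0 HC] := flat_le_sqr p.
  have f0 q : flat q 0 = 0 by rewrite /flat ltxx.
  rewrite f0.
  have cv : h^-1 *: ((flat p \o shift 0) (h *: 1) - flat p 0) @[h --> 0^'] --> 0.
    apply/cvgr0Pnorm_le => e e0; near=> h.
    rewrite /= f0 subr0 addr0 /GRing.scale/= mulr1 normrM normfV.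
    rewrite mulrC ler_pdivrMr; last first.
      by rewrite normr_gt0; near: h; exact: nbhs_dnbhs_neq.
    apply: le_trans (HC _) _; rewrite -real_normK ?num_real// expr2 mulrA.
    rewrite ler_wpM2r//.
    (* [C] may be 0; [C + 1] can be divided by. *)
    apply: (@le_trans _ _ ((C + 1) * `|h|)); first by rewrite ler_wpM2r// lerDl.
    rewrite mulrC -ler_pdivlMr; last by rewrite ltr_wpDl.
    near: h; apply: dnbhs0_le; rewrite divr_gt0//; by rewrite ltr_wpDl.
  apply: DeriveDef; first by apply/cvg_ex; exists 0.
  exact: cvg_lim.
Unshelve. all: by end_near. Qed.

Lemma smooth_flat p : smooth (flat p).
Proof.
apply/smoothP => n; elim: n p => //= n IH p; split.
  by move=> t; have [] := is_derive_flat p t.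
rewrite (_ : derive1 _ = flat ((p - p^`()) * 'X^2)); first exact: IH.
apply/funext => t; rewrite derive1E; have [] := is_derive_flat p t.
by [].
Qed.

End smooth_functions.

(** * Smooth steps and the bumps that are their derivatives *)

Section smooth_step.
Context {R : realType}.
Implicit Types (s e x y : R).

Lemma flat_le0 p x : x <= 0 -> flat p x = 0.
Proof. by move=> x0; rewrite /flat ltNge x0. Qed.

Lemma flatXn_ge0 n x : 0 <= flat 'X^n x.
Proof.
rewrite /flat; case: ifP => // x0.
by rewrite hornerXn mulr_ge0 ?expR_ge0// exprn_ge0// invr_ge0 ltW.
Qed.

Lemma flat1_ge0 x : 0 <= flat 1 x.
Proof. by have := flatXn_ge0 0 x; rewrite expr0. Qed.

Lemma flat1_gt0 x : 0 < x -> 0 < flat 1 x.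
Proof. by move=> x0; rewrite /flat x0 hornerC mul1r expR_gt0. Qed.

Lemma flat1_ndecr x y : x <= y -> flat 1 x <= flat 1 y.
Proof.
move=> xy; have [x0|x0] := leP x 0; first by rewrite flat_le0// flat1_ge0.
have y0 := lt_le_trans x0 xy.
by rewrite /flat x0 y0 !hornerC !mul1r ler_expR lerN2 lef_pV2// posrE.
Qed.

(* Equals [0] left of [s] and a positive constant independent of [s] right of [s + e]. *)
Definition smooth_step s e x : R := flat 1 (flat 1 e - flat 1 (s + e - x)).

Lemma smooth_smooth_step s e : smooth (smooth_step s e).
Proof.
apply: (@smooth_comp _ (flat 1)); first exact: smooth_flat.
apply: (@smooth_comp _ (fun x => flat 1 e - x)); first exact: smooth_reflect.
apply: (@smooth_comp _ (flat 1)); first exact: smooth_flat.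
exact: smooth_reflect.
Qed.

Lemma smooth_step_left s e x : x <= s -> smooth_step s e x = 0.
Proof.
by move=> xs; rewrite /smooth_step flat_le0// subr_le0 flat1_ndecr//; lra.
Qed.

Lemma smooth_step_right s e x : s + e <= x ->
  smooth_step s e x = flat 1 (flat 1 e).
Proof.
by move=> sx; rewrite /smooth_step [X in _ - X]flat_le0 ?subr0// subr_le0.
Qed.

(** [flat 'X^2] is the derivative of [flat 1]. Both factors are nonnegative, and one of them
    vanishes on each side of the interval from [s] to [s + e]: the derivative of a step is a bump,
    used below as an averaging kernel. *)
Lemma derive1_smooth_step s e x : derive1 (smooth_step s e) x =
  flat 'X^2 (flat 1 e - flat 1 (s + e - x)) * flat 'X^2 (s + e - x).
Proof.
have dflat y : is_derive y 1 (flat 1) (flat 'X^2 y).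
  by have := is_derive_flat 1 y; rewrite -polyC1 derivC subr0 polyC1 mul1r.
have d1 : is_derive x 1 (fun x => s + e - x) (-1).
  have := is_deriveB (is_derive_cst (s + e) x 1) (is_derive_id x 1).
  by rewrite sub0r.
have d2 := @is_derive1_comp _ (flat 1) (fun x => s + e - x) _ _ _ (dflat _) d1.
have d3 := is_deriveB (is_derive_cst (flat 1 e) x 1) d2.
have d4 := @is_derive1_comp _ (flat 1)
  (fun x => flat 1 e - flat 1 (s + e - x)) _ _ _ (dflat _) d3.
rewrite derive1E; transitivity (flat 'X^2 (flat 1 e - flat 1 (s + e - x)) *
   (0 - flat 'X^2 (s + e - x) * -1)); first exact: (@derive_val _ _ _ _ _ _ _ d4).
by rewrite mulrN1 opprK add0r.
Qed.

Lemma derive1_smooth_step_ge0 s e x : 0 <= derive1 (smooth_step s e) x.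
Proof. by rewrite derive1_smooth_step mulr_ge0// flatXn_ge0. Qed.

Lemma derive1_smooth_step_eq0 s e x : (x <= s) || (s + e <= x) ->
  derive1 (smooth_step s e) x = 0.
Proof.
rewrite derive1_smooth_step => /orP[xs|sx].
  by rewrite flat_le0 ?mul0r// subr_le0 flat1_ndecr//; lra.
by rewrite mulrC flat_le0 ?mul0r// subr_le0.
Qed.

End smooth_step.

(** * Weak derivatives on the line *)

Section weak_derivative.
Context {R : realType}.
Notation mu := (@lebesgue_measure R).
Implicit Types (f g phi : R -> R) (a b : R).

Lemma continuous_integrable f a b : {within `[a, b], continuous f} ->
  mu.-integrable `[a, b] (EFin \o f).
Proof. by apply: continuous_compact_integrable; exact: segment_compact. Qed.

Lemma within_continuousD f g (I : set R) : {within I, continuous f} ->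
  {within I, continuous g} -> {within I, continuous (f \+ g)}.
Proof.
move=> /subspace_continuousP cf /subspace_continuousP cg.
by apply/subspace_continuousP => x Ix; apply: cvgD; [exact: cf|exact: cg].
Qed.

Lemma within_continuousM f g (I : set R) : {within I, continuous f} ->
  {within I, continuous g} -> {within I, continuous (f \* g)}.
Proof.
move=> /subspace_continuousP cf /subspace_continuousP cg.
by apply/subspace_continuousP => x Ix; apply: cvgM; [exact: cf|exact: cg].
Qed.

Lemma smooth_LRcontinuous f a b : smooth f -> derivable_oo_LRcontinuous f a b.
Proof.
move=> sf; split=> [x _||]; first exact: smooth_derivable.
  exact/cvg_at_right_filter/smooth_continuous.
exact/cvg_at_left_filter/smooth_continuous.
Qed.

Lemma smooth_within f (I : set R) : smooth f -> {within I, continuous f}.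
Proof. by move=> sf; apply/continuous_subspaceT/smooth_continuous. Qed.

Lemma Rintegral_derive1 f a b : a < b -> smooth f ->
  \int[mu]_(x in `[a, b]) derive1 f x = f b - f a.
Proof.
move=> ab sf; rewrite /Rintegral (@continuous_FTC2 _ _ f)//.
- exact/smooth_within/smooth_derive1.
- exact: smooth_LRcontinuous.
Qed.

Lemma integrable_derive1_smooth_stepM s e a b (c : R) :
  mu.-integrable `[a, b] (fun x => (derive1 (smooth_step s e) x * c)%:E).
Proof.
apply: continuous_integrable; apply: within_continuousM.
  by apply: smooth_within; apply: smooth_derive1; exact: smooth_smooth_step.
by apply: continuous_subspaceT => x; exact: cst_continuous.
Qed.

(** The mass of the bump is the height of the plateau, the same wherever the bump sits; this makes
    averages at two points comparable. *)
Lemma Rintegral_derive1_smooth_stepM s e a b (c : R) : 0 < e -> a <= s -> s + e <= b ->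
  \int[mu]_(x in `[a, b]) (derive1 (smooth_step s e) x * c) =
  flat 1 (flat 1 e) * c.
Proof.
move=> e0 as_ seb; have ab : a < b by lra.
have sE : smooth (smooth_step s e) by exact: smooth_smooth_step.
have iE : mu.-integrable `[a, b] (EFin \o derive1 (smooth_step s e)).
  by apply: continuous_integrable; apply: smooth_within; exact: smooth_derive1.
rewrite (RintegralZr c _ iE)// Rintegral_derive1//.
by rewrite smooth_step_right// smooth_step_left// subr0.
Qed.

(* Testing against the difference of two smooth steps compares local averages
   of [f] at [s] and at [t]. *)
Lemma weak_derivative0_le f a b : {within `[a, b], continuous f} ->
  (forall phi c d, smooth phi -> a < c -> d < b ->
     (forall t, (t < c) || (d < t) -> phi t = 0) ->
     \int[mu]_(t in `[a, b]) (derive1 phi t * f t) = 0) ->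
  forall s t, s \in `]a, b[ -> t \in `]a, b[ -> f t <= f s.
Proof.
move=> cf f0 s t sab tab; rewrite leNgt; apply/negP => fst.
have ab : a < b by move: sab; rewrite in_itv/= => /andP[]; exact: lt_trans.
have := cf; rewrite continuous_within_itvP// => -[cfoo _ _].
(* The levels at one and two thirds separate the values of [f] near [s] from those near [t]. *)
pose l1 := f s + (f t - f s) / 3; pose l2 := f t - (f t - f s) / 3.
have fsl1 : f s < l1 by rewrite /l1; lra.
have l2ft : l2 < f t by rewrite /l2; lra.
have l12 : l1 < l2 by rewrite /l1 /l2; lra.
move: (sab) (tab); rewrite !in_itv/= => /andP[sa sb] /andP[ta tb].
have [e [e0 seb teb fl1 fl2]] : exists e, [/\ 0 < e, s + e < b, t + e < b,
    forall x, s <= x <= s + e -> f x <= l1 &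
    forall x, t <= x <= t + e -> l2 <= f x].
  have /cvgr_dist_le/(_ (l1 - f s)) := cfoo _ sab.
  rewrite subr_gt0 => /(_ fsl1) /nbhs_ballP[r1 /= r10 H1].
  have /cvgr_dist_le/(_ (f t - l2)) := cfoo _ tab.
  rewrite subr_gt0 => /(_ l2ft) /nbhs_ballP[r2 /= r20 H2].
  pose e := Num.min (Num.min (r1 / 2) (r2 / 2)) (Num.min ((b - s) / 2) ((b - t) / 2)).
  have [er1 er2 es et] : [/\ e <= r1 / 2, e <= r2 / 2, e <= (b - s) / 2 & e <= (b - t) / 2].
    by rewrite /e; split; rewrite !ge_min lexx ?orbT.
  have e0 : 0 < e by rewrite /e !lt_min !divr_gt0// subr_gt0.
  exists e; split => //; [lra|lra| |].
    move=> x xs; have /H1 : ball s r1 x by rewrite /ball/= ltr_distlC; lra.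
    by rewrite ler_distlC; lra.
  move=> x xs; have /H2 : ball t r2 x by rewrite /ball/= ltr_distlC; lra.
  by rewrite ler_distlC; lra.
pose C := flat 1 (flat 1 e).
have C0 : 0 < C by rewrite flat1_gt0// flat1_gt0.
(* The two plateaus have equal height, so the difference vanishes on the far right as well as on the
   far left. *)
pose phi := smooth_step s e \- smooth_step t e.
have sphi : smooth phi by apply: smoothB; exact: smooth_smooth_step.
have dE r : smooth (derive1 (smooth_step r e)) by exact/smooth_derive1/smooth_smooth_step.
have iEf r : mu.-integrable `[a, b] (fun x => (derive1 (smooth_step r e) x * f x)%:E).
  by apply: continuous_integrable; apply: within_continuousM => //; exact: smooth_within.
have iEc r c : mu.-integrable `[a, b] (fun x => (derive1 (smooth_step r e) x * c)%:E).
  exact: integrable_derive1_smooth_stepM.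
have : \int[mu]_(x in `[a, b]) (derive1 phi x * f x) = 0.
  apply: (f0 phi (Num.min s t) (Num.max s t + e)) => //.
  - by rewrite lt_min sa.
  - by rewrite -ltrBrDr gt_max !ltrBrDr seb.
  - move=> x; rewrite lt_min -ltrBrDr gt_max !ltrBrDr /phi/= => /orP[/andP[xs xt]|/andP[sx tx]].
      by rewrite !smooth_step_left ?subrr// ltW.
    by rewrite !smooth_step_right ?subrr// ltW// addrC.
move=> phif0.
have IsIt : \int[mu]_(x in `[a, b]) (derive1 (smooth_step s e) x * f x) =
    \int[mu]_(x in `[a, b]) (derive1 (smooth_step t e) x * f x).
  apply/eqP; rewrite -subr_eq0 -(RintegralB _ (iEf s) (iEf t))//; apply/eqP.
  rewrite -[RHS]phif0; apply: eq_Rintegral.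
  move=> x _; rewrite -mulrBl; congr (_ * _).
  by rewrite !derive1E deriveB//; exact/smooth_derivable/smooth_smooth_step.
have Is : \int[mu]_(x in `[a, b]) (derive1 (smooth_step s e) x * f x) <= C * l1.
  rewrite /C -(@Rintegral_derive1_smooth_stepM s e a b l1 e0 (ltW sa) (ltW seb)).
  apply: le_Rintegral; [by []|exact: iEf|exact: iEc|].
  move=> x _.
  have [|] := boolP ((x <= s) || (s + e <= x)).
    by move=> /derive1_smooth_step_eq0 ->; rewrite !mul0r.
  rewrite negb_or -!ltNge => /andP[xs xe].
  by apply: ler_wpM2l; [exact: derive1_smooth_step_ge0|apply: fl1; rewrite (ltW xs) (ltW xe)].
have It : C * l2 <= \int[mu]_(x in `[a, b]) (derive1 (smooth_step t e) x * f x).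
  rewrite /C -(@Rintegral_derive1_smooth_stepM t e a b l2 e0 (ltW ta) (ltW teb)).
  apply: le_Rintegral; [by []|exact: iEc|exact: iEf|].
  move=> x _.
  have [|] := boolP ((x <= t) || (t + e <= x)).
    by move=> /derive1_smooth_step_eq0 ->; rewrite !mul0r.
  rewrite negb_or -!ltNge => /andP[xs xe].
  by apply: ler_wpM2l; [exact: derive1_smooth_step_ge0|apply: fl2; rewrite (ltW xs) (ltW xe)].
move: Is; rewrite IsIt => /(le_trans It).
by rewrite (ler_pM2l C0) leNgt l12.
Qed.

Lemma within_continuousB f g (I : set R) : {within I, continuous f} ->
  {within I, continuous g} -> {within I, continuous (f \- g)}.
Proof.
move=> /subspace_continuousP cf /subspace_continuousP cg.
by apply/subspace_continuousP => x Ix; apply: cvgB; [exact: cf|exact: cg].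
Qed.

(** Du Bois-Reymond: subtracting a primitive of [k] leaves a function with zero weak derivative,
    hence a constant. *)
Lemma weak_derivative_is_derive (I : set R) g k : open I ->
  {in I, continuous g} -> {in I, continuous k} ->
  (forall phi a b, a < b -> `[a, b] `<=` I -> smooth phi ->
     (forall t, (t <= a) || (b <= t) -> phi t = 0) ->
     \int[mu]_(t in `[a, b]) (derive1 phi t * g t + phi t * k t) = 0) ->
  forall t, I t -> is_derive t 1 g (k t).
Proof.
move=> oI cg ck gk0 t It.
have [r /= r0 rI] : exists2 r, 0 < r & ball t r `<=` I by exact/nbhs_ballP/open_nbhs_nbhs.
pose a := t - r / 2; pose b := t + r / 2.
have ab : a < b by rewrite /a /b; lra.
have abI : `[a, b] `<=` I.
  move=> x /=; rewrite in_itv/= /a /b => xab; apply: rI.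
  by rewrite /ball/= ltr_distlC; lra.
have tab : t \in `]a, b[ by rewrite in_itv/= /a /b; lra.
have cgab : {within `[a, b], continuous g}.
  by apply: continuous_in_subspaceT => x /[!inE] xab; apply: cg; rewrite inE; exact: abI.
have ckab : {within `[a, b], continuous k}.
  by apply: continuous_in_subspaceT => x /[!inE] xab; apply: ck; rewrite inE; exact: abI.
have ik := continuous_integrable ckab.
pose p := (parameterized_integral mu a)^~ k.
have cp : {within `[a, b], continuous p}.
  exact: parameterized_integral_continuous (ltW ab) ik.
have dp x : x \in `]a, b[ -> derivable p x 1 /\ derive1 p x = k x.
  move=> xab; move: (xab); rewrite in_itv/= => /andP[ax xb].
  apply: (continuous_FTC1_closed xb ik ax); apply: ck; rewrite inE; apply: abI.
  exact: subset_itv_oo_cc.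
(* Integration by parts turns the term in [phi * k] into minus the one in [p * phi'], the boundary
   terms vanishing with [phi]. Used in both orders, the inequality says that [g - p] is constant. *)
have const x y : x \in `]a, b[ -> y \in `]a, b[ -> g y - p y <= g x - p x.
  apply: (@weak_derivative0_le (g \- p)); first exact: within_continuousB.
  move=> phi c d sphi ac db phi0.
  have phi0' x' : (x' <= a) || (b <= x') -> phi x' = 0.
    by case/orP=> h; apply: phi0; [rewrite (le_lt_trans h ac)|rewrite (lt_le_trans db h) orbT].
  have := gk0 phi a b ab abI sphi phi0'.
  have sphi' : smooth (derive1 phi) by exact: smooth_derive1.
  have iphig : mu.-integrable `[a, b] (fun x => (derive1 phi x * g x)%:E).
    by apply: continuous_integrable; apply: within_continuousM => //; exact: smooth_within.
  have iphip : mu.-integrable `[a, b] (fun x => (p x * derive1 phi x)%:E).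
    by apply: continuous_integrable; apply: within_continuousM => //; exact: smooth_within.
  have iphik : mu.-integrable `[a, b] (fun x => (phi x * k x)%:E).
    by apply: continuous_integrable; apply: within_continuousM => //; exact: smooth_within.
  have := cp; rewrite continuous_within_itvP// => -[_ cpa cpb].
  have := @Rintegration_by_parts _ p phi k (derive1 phi) a b ab ckab.
  rewrite !phi0' ?lexx ?orbT// !mulr0 subrr sub0r => bp.
  rewrite (RintegralD _ iphig iphik)//.
  have -> : \int[mu]_(x in `[a, b]) (phi x * k x) =
      - \int[mu]_(x in `[a, b]) (p x * derive1 phi x).
    rewrite bp ?opprK; first by apply: eq_Rintegral => ? _; rewrite mulrC.
    - by split=> // ? /dp[].
    - by move=> ? /dp[].
    - exact: smooth_within.
    - exact: smooth_LRcontinuous.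
    - by [].
  rewrite -(RintegralB _ iphig iphip)// => <-.
  by apply: eq_Rintegral => ? _; rewrite mulrBr; congr (_ - _); rewrite mulrC.
have [dpt kt] := dp _ tab.
have : is_derive t 1 (fun x => p x + (g t - p t)) (k t).
  have dp' : is_derive t 1 p (k t) by rewrite -kt derive1E; exact: derivableP.
  have := is_deriveD dp' (is_derive_cst (g t - p t) t 1).
  by rewrite addr0.
apply: near_eq_is_derive.
near=> x.
have xab : x \in `]a, b[ by near: x; exact: near_in_itvoo.
have : g x - p x = g t - p t by apply/eqP; rewrite eq_le !const.
by move=> <-; rewrite addrC subrK.
Unshelve. all: by end_near. Qed.

End weak_derivative.

(** * Real inner product, projection and resolvents *)

Section real_inner_product.
Context {R : realType} {H : completeNormedModType R[i]}.
Variable dot : {dot H for Num.conj}.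
Hypothesis dot_norm : forall x : H, `|x| ^+ 2 = dot x x.
Implicit Types x y : H.

(** Real parts keep all estimates in the ordered field [R]. Nothing is lost: the imaginary part is
    recovered by multiplying an argument by i, as in [rdotir]. *)
Definition re_dot x y : R := complex.Re (dot x y).
Definition rnorm x : R := complex.Re `|x|.

Local Notation rdot := re_dot.

Let ReD (z w : R[i]) : complex.Re (z + w) = complex.Re z + complex.Re w.
Proof. by case: z w => [? ?] [? ?]. Qed.

Let ReN (z : R[i]) : complex.Re (- z) = - complex.Re z.
Proof. by case: z. Qed.

Lemma rnormE x : `|x| = (rnorm x)%:C%C.
Proof. by rewrite /rnorm RRe_real// normr_real. Qed.

Lemma rnorm_ge0 x : 0 <= rnorm x.
Proof. by have := normr_ge0 x; rewrite rnormE ler0c. Qed.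

Lemma rnorm_eq0 x : (rnorm x == 0) = (x == 0).
Proof. by rewrite -(normr_eq0 x) rnormE eq_complex/= eqxx andbT. Qed.

Lemma rdotxx x : rdot x x = rnorm x ^+ 2.
Proof. rewrite /re_dot -dot_norm rnormE !expr2 /=; ring. Qed.

Lemma dotC x y : dot x y = conjc (dot y x).
Proof. by rewrite (hermC dot) expr0 mul1r. Qed.

Lemma rdotC x y : rdot x y = rdot y x.
Proof. by rewrite /re_dot dotC; case: (dot y x). Qed.

Lemma rdotDl x y z : rdot (x + y) z = rdot x z + rdot y z.
Proof. by rewrite /re_dot linearDl ReD. Qed.

Lemma rdotDr x y z : rdot z (x + y) = rdot z x + rdot z y.
Proof. by rewrite /re_dot linearDr ReD. Qed.

Lemma rdotNl x y : rdot (- x) y = - rdot x y.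
Proof. by rewrite /re_dot linearNl ReN. Qed.

Lemma rdotNr x y : rdot x (- y) = - rdot x y.
Proof. by rewrite /re_dot linearNr ReN. Qed.

Lemma rdotZl (c : R) x y : rdot (c%:C%C *: x) y = c * rdot x y.
Proof.
rewrite /re_dot linearZl_LR /=; case: (dot x y) => p q /=; by rewrite mul0r subr0.
Qed.

Lemma rdotZr (c : R) x y : rdot x (c%:C%C *: y) = c * rdot x y.
Proof. by rewrite rdotC rdotZl rdotC. Qed.

Lemma rdotZcl z x y : rdot (z *: x) y = rdot x (conjc z *: y).
Proof.
rewrite /re_dot linearZl_LR linearZr_LR /=.
by congr (complex.Re (_ * _)); exact: esym (conjcK z).
Qed.

Lemma rdot0r x : rdot x 0 = 0.
Proof. by rewrite /re_dot linear0r. Qed.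

Lemma rdotil x y : rdot ('i%C *: x) y = - complex.Im (dot x y).
Proof.
by rewrite /re_dot linearZl_LR /=; case: (dot x y) => p q /=; rewrite mul0r mul1r sub0r.
Qed.

Lemma rdotir x y : rdot x ('i%C *: y) = complex.Im (dot x y).
Proof.
by rewrite /re_dot linearZr_LR /=; case: (dot x y) => p q /=; rewrite mul0r sub0r mulN1r opprK.
Qed.

Lemma rdot_ii x y : rdot ('i%C *: x) ('i%C *: y) = rdot x y.
Proof. by rewrite rdotir linearZl_LR /= mulrC ImiRe. Qed.

Lemma rnormD_sqr x y :
  rnorm (x + y) ^+ 2 = rnorm x ^+ 2 + 2 * rdot x y + rnorm y ^+ 2.
Proof. rewrite -!rdotxx !rdotDl !rdotDr (rdotC y x); ring. Qed.

Lemma rnormN x : rnorm (- x) = rnorm x.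
Proof. by rewrite /rnorm normrN. Qed.

Lemma rnormB_sqr x y :
  rnorm (x - y) ^+ 2 = rnorm x ^+ 2 - 2 * rdot x y + rnorm y ^+ 2.
Proof. by rewrite rnormD_sqr rdotNr rnormN mulrN. Qed.

Lemma rnormD x y : rnorm (x + y) <= rnorm x + rnorm y.
Proof.
by have := ler_normD x y; rewrite !rnormE -rmorphD lecR.
Qed.

Lemma rnormZ (c : R) x : rnorm (c%:C%C *: x) = `|c| * rnorm x.
Proof.
apply/eqP; rewrite -(@eqrXn2 _ 2)// ?mulr_ge0 ?rnorm_ge0//.
by rewrite -rdotxx rdotZl rdotZr mulrA -expr2 exprMn real_normK ?num_real// rdotxx.
Qed.

(** The squared norm of |v| u - |u| v equals 2 |u| |v| (|u| |v| - (u, v)). The factor is divided out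
    when it is nonzero; the remaining cases are trivial. *)
Lemma rdot_CauchySchwarz x y : `|rdot x y| <= rnorm x * rnorm y.
Proof.
suff CS u v : rdot u v <= rnorm u * rnorm v.
  by rewrite ler_norml lerNl -rdotNr CS andbT -(rnormN y) CS.
have u0 := rnorm_ge0 u; have v0 := rnorm_ge0 v.
have := sqr_ge0 (rnorm ((rnorm v)%:C%C *: u - (rnorm u)%:C%C *: v)).
rewrite rnormB_sqr !rnormZ rdotZl rdotZr !ger0_norm// => h.
have [u0'|un0] := eqVneq (rnorm u) 0.
  have /eqP -> : u == 0 by rewrite -rnorm_eq0 u0'.
  by rewrite /re_dot linear0l mulr_ge0 ?rnorm_ge0.
have [v0'|vn0] := eqVneq (rnorm v) 0.
  have /eqP -> : v == 0 by rewrite -rnorm_eq0 v0'.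
  by rewrite /re_dot linear0r mulr_ge0 ?rnorm_ge0.
have uv0 : 0 < rnorm u * rnorm v.
  by apply: mulr_gt0; rewrite lt_neqAle eq_sym ?un0 ?vn0.
rewrite -(ler_pM2l uv0); lra.
Qed.

End real_inner_product.

(** * Orthogonal projection onto a closed real subspace *)

Section hilbert_projection.
Context {R : realType} {H : completeNormedModType R[i]}.
Variable dot : {dot H for Num.conj}.
Hypothesis dot_norm : forall x : H, `|x| ^+ 2 = dot x x.
Implicit Types x y : H.
Local Notation rdot := (re_dot dot).

Lemma cvg_rnormP (T : Type) (F : set_system T) (FF : Filter F) (f : T -> H) (l : H) :
  (f @ F --> l) <-> forall e : R, 0 < e -> \forall x \near F, rnorm (l - f x) < e.
Proof.
split=> [/cvgrPdist_lt fl e e0|fl].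
  have e0' : 0 < e%:C%C by rewrite ltcR.
  by apply: filterS (fl _ e0') => x; rewrite rnormE ltcR.
apply/cvgrPdist_lt => -[e e'] ; rewrite ltcE /= => /andP[/eqP -> e0].
by apply: filterS (fl _ e0) => x; rewrite rnormE ltcR.
Qed.

Lemma rnorm_cauchy_cvg (u : nat -> H) :
  (forall e : R, 0 < e -> \forall N \near \oo, \forall n \near \oo, rnorm (u N - u n) < e) ->
  exists l : H, u @ \oo --> l.
Proof.
move=> cu; suff : cvg (u @ \oo) by move=> /cvg_ex.
apply: cauchy_cvg; apply: cauchy_exP => -[e e']; rewrite ltcE /= => /andP[/eqP -> e0].
have /filter_ex[N HN] := cu _ e0.
exists (u N); apply: filterS HN => n.
by rewrite -ball_normE /ball_/= rnormE ltcR.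
Qed.

(** With X the inner product and Q the squared norm of [y], suppose X > 0 and take t = X / (Q + 1)
    and e = X t. The hypothesis then reads X <= t Q, although X = t Q + t. *)
Lemma rdot_eps_le0 (x y : H) :
  (forall e t : R, 0 < e -> 0 < t -> 2 * t * rdot x y <= e + t ^+ 2 * rnorm y ^+ 2) ->
  rdot x y <= 0.
Proof.
move=> h; rewrite leNgt; apply/negP => X0.
set X := rdot x y in h X0; set Q := rnorm y ^+ 2 in h.
have Q0 : 0 <= Q by exact: sqr_ge0.
have t0 : 0 < X / (Q + 1) by rewrite divr_gt0// ltr_wpDl.
move: t0 (h (X * (X / (Q + 1)))); set t := X / (Q + 1) => t0.
move=> /(_ t (mulr_gt0 X0 t0) t0).
have -> : X = t * (Q + 1) by rewrite /t divfK// gt_eqF// ltr_wpDl.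
have := mulr_gt0 t0 t0; lra.
Qed.

(** Near minimality of [u n] already gives near orthogonality of [y - u n] to [V]. This one
    estimate, [quad], yields both the Cauchy property of the minimising sequence and the
    orthogonality of the limit. *)
Lemma hilbert_projection (V : set H) (y : H) : V !=set0 ->
  (forall (c : R) v w, V v -> V w -> V (v + c%:C%C *: w)) ->
  (forall (u : nat -> H) l, (forall n, V (u n)) -> u @ \oo --> l -> V l) ->
  exists2 p, V p & forall v, V v -> rdot (y - p) v = 0.
Proof.
move=> [v0 Vv0] linV clV.
pose E := [set rnorm (y - v) ^+ 2 | v in V].
have hE : has_inf E.
  split; first by exists (rnorm (y - v0) ^+ 2), v0.
  by exists 0 => _ [v _ <-]; exact: sqr_ge0.
have Em v : V v -> inf E <= rnorm (y - v) ^+ 2.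
  by move=> Vv; apply: ge_inf; [exact: hE.2|exists v].
have /choice[u Hu] n : exists v, V v /\ rnorm (y - v) ^+ 2 < inf E + n.+1%:R^-1.
  have n0 : 0 < (n.+1%:R^-1 : R) by rewrite invr_gt0 ltr0n.
  by have [_ [v Vv <-] vn] := inf_adherent n0 hE; exists v.
have quad n v (t : R) : V v ->
    2 * t * rdot (y - u n) v <= n.+1%:R^-1 + t ^+ 2 * rnorm v ^+ 2.
  move=> Vv; have [Vun un] := Hu n.
  have := Em _ (linV t _ _ Vun Vv).
  rewrite opprD addrA (rnormB_sqr dot_norm) rdotZr (rnormZ dot_norm) exprMn real_normK ?num_real//.
  move: un; set a := rnorm _ ^+ 2; set c := _.+1%:R^-1; lra.
have close n k : rnorm (u n - u k) ^+ 2 <= 2 * n.+1%:R^-1 + 4 * k.+1%:R^-1.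
  have [Vn un] := Hu n; have [Vk _] := Hu k.
  have Vnk : V (u n + (-1)%:C%C *: u k) by exact: linV.
  (* For t = 1/2 the quadratic term costs only half of the squared distance between [u n] and [u k],
     so the other half remains bounded. *)
  have := quad k _ 2^-1 Vnk; have := Em _ Vk.
  rewrite rmorphN1 scaleN1r.
  have := rnormB_sqr dot_norm (y - u k) (u n - u k).
  rewrite opprB addrA subrK => Eun; move: un; rewrite Eun.
  move: (n.+1%:R^-1) (k.+1%:R^-1) (inf E) => c c' d; lra.
have [|p up] := rnorm_cauchy_cvg (u := u).
  move=> e e0; have e8 : 0 < e ^+ 2 / 8 by rewrite divr_gt0// exprn_gt0.
  near=> N; near=> n.
  rewrite -(@ltr_pXn2r _ 2) ?nnegrE ?rnorm_ge0 ?(ltW e0)//.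
  apply: le_lt_trans (close N n) _.
  have : N.+1%:R^-1 < e ^+ 2 / 8 by near: N; exact: near_infty_natSinv_lt (PosNum e8).
  have : n.+1%:R^-1 < e ^+ 2 / 8 by near: n; exact: near_infty_natSinv_lt (PosNum e8).
  move: (n.+1%:R^-1) (N.+1%:R^-1) => c c'; lra.
have Vp : V p by apply: clV up => n; exact: (Hu n).1.
exists p => //.
have le0 v : V v -> rdot (y - p) v <= 0.
  move=> Vv; apply: rdot_eps_le0 => e t e0 t0.
  have v1 : 0 < rnorm v + 1 by rewrite ltr_wpDl// rnorm_ge0.
  have t4 : 0 < 4 * t * (rnorm v + 1) by rewrite !mulr_gt0.
  have e2 : 0 < e / 2 by rewrite divr_gt0.
  have d0 : 0 < e / (4 * t * (rnorm v + 1)) by rewrite divr_gt0.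
  near \oo => n.
  have : n.+1%:R^-1 < e / 2 by near: n; exact: near_infty_natSinv_lt (PosNum e2).
  have : rnorm (p - u n) < e / (4 * t * (rnorm v + 1)).
    by near: n; move/cvg_rnormP : up; apply.
  rewrite ltr_pdivlMr// => pun.
  have -> : y - p = (y - u n) + (u n - p) by rewrite addrA subrK.
  rewrite rdotDl; have := quad n v t Vv.
  have : t * rdot (u n - p) v <= t * (rnorm (p - u n) * (rnorm v + 1)).
    rewrite ler_wpM2l ?(ltW t0)// -(rnormN (p - u n)) opprB.
    apply: le_trans (ler_norm _) _; apply: le_trans (rdot_CauchySchwarz dot_norm _ _) _.
    by rewrite ler_wpM2l ?rnorm_ge0// lerDl.
  move: pun (n.+1%:R^-1); set s := rnorm (p - u n); set w := rnorm v.
  set a := rdot (y - u n) v; set b := rdot _ v => pun c; lra.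
move=> v Vv; apply/eqP; rewrite eq_le le0//=.
(* This vector is - v; the closure hypothesis on [V] produces the opposite in this form. *)
have : V (v + (-2)%:C%C *: v) by exact: linV.
move=> /le0; rewrite rdotDr rdotZr//; lra.
Unshelve. all: by end_near. Qed.

End hilbert_projection.

(** * Surjectivity of A + i and A - i for selfadjoint A *)

Section resolvent.
Context {R : realType} {H : completeNormedModType R[i]}.
Variable dot : {dot H for Num.conj}.
Hypothesis dot_norm : forall x : H, `|x| ^+ 2 = dot x x.
Implicit Types x y : H.
Local Notation rdot := (re_dot dot).

Lemma rdot_ir x y : rdot x ('i%C *: y) = - rdot ('i%C *: x) y.
Proof. by rewrite rdotir rdotil opprK. Qed.

Lemma rnorm_i x : rnorm ('i%C *: x) = rnorm x.
Proof.
apply/eqP; rewrite -(@eqrXn2 _ 2)// ?rnorm_ge0//.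
by rewrite -!(rdotxx dot_norm) rdot_ii.
Qed.

Lemma cvg_rdotl (T : Type) (F : set_system T) (FF : Filter F) (f : T -> H) (l y : H) :
  f @ F --> l -> (fun t => rdot (f t) y) @ F --> rdot l y.
Proof.
move=> /cvg_rnormP fl; apply/cvgrPdist_lt => e e0.
have y1 : 0 < rnorm y + 1 by rewrite ltr_wpDl// rnorm_ge0.
have := fl _ (divr_gt0 e0 y1); apply: filterS => t.
rewrite ltr_pdivlMr// -rdotNl -rdotDl; apply: le_lt_trans.
apply: le_trans (rdot_CauchySchwarz dot_norm _ _) _.
by rewrite ler_wpM2l ?rnorm_ge0// lerDl.
Qed.

Variables (D : set H) (A : H -> H).
Hypothesis (A_linear : linear_on D A) (A_selfadjoint : selfadjoint dot D A).

Lemma linear_on0 : A 0 = 0.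
Proof.
have [D0 AL] := A_linear; have [_] := AL 1 0 0 D0 D0.
by rewrite !scale1r addr0 => /esym/eqP; rewrite -subr_eq0 addrK => /eqP.
Qed.

Lemma linear_onZ z x : D x -> D (z *: x) /\ A (z *: x) = z *: A x.
Proof.
move=> Dx; have [D0 AL] := A_linear; have := AL z x 0 Dx D0.
by rewrite linear_on0 !addr0.
Qed.

Lemma linear_onD x y : D x -> D y -> D (x + y) /\ A (x + y) = A x + A y.
Proof.
by move=> Dx Dy; have [D0 AL] := A_linear; have := AL 1 x y Dx Dy; rewrite !scale1r.
Qed.

Lemma selfadjoint_sym x y : D x -> D y -> dot x (A y) = dot (A x) y.
Proof.
move=> Dx Dy; have [_ AE] := A_selfadjoint.
have : op_graph D A (x, A x) by [].
by rewrite -AE => -[_ _ /(_ (y, A y))]; apply.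
Qed.

(** Replacing [f] by i f, which stays in [D], turns equality of real parts into equality of
    imaginary parts, so the real inner product detects the adjoint. *)
Lemma selfadjoint_rdot x y :
  (forall f, D f -> rdot x (A f) = rdot y f) -> D x /\ y = A x.
Proof.
move=> xy; have [_ AE] := A_selfadjoint.
suff : op_graph D A (x, y) by [].
rewrite -AE; split=> // -[f b] [/= Df ->].
have [Di Ai] := linear_onZ 'i%C Df.
have := xy _ Di; rewrite Ai !rdotir => Im_eq.
by apply/eqP; rewrite eq_complex Im_eq eqxx andbT; apply/eqP; exact: xy.
Qed.

Lemma rdot_selfadjoint_i x : D x -> rdot (A x) ('i%C *: x) = 0.
Proof.
move=> Dx; have := dotC dot (A x) x.
rewrite rdotir (selfadjoint_sym Dx Dx).
by case: (dot (A x) x) => p q [] qN /=; lra.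
Qed.

(** The operator A + s i; with s = 1 or -1 it covers both resolvents at once. *)
Definition shifted (s : R) x : H := A x + s%:C%C *: ('i%C *: x).

Lemma shiftedD s (c : R) x y : D x -> D y ->
  D (x + c%:C%C *: y) /\ shifted s (x + c%:C%C *: y) = shifted s x + c%:C%C *: shifted s y.
Proof.
move=> Dx Dy; have [Dcy Acy] := linear_onZ c%:C%C Dy.
have [Dxy Axy] := linear_onD Dx Dcy; split=> //.
rewrite /shifted Axy Acy !scalerDr !scalerA addrACA; congr (_ + (_ + _ *: _)).
ring.
Qed.

(** The cross term is the imaginary part of (A x, x), which is 0 by symmetry. *)
Lemma rnorm_shifted s x : s ^+ 2 = 1 -> D x ->
  rnorm (shifted s x) ^+ 2 = rnorm (A x) ^+ 2 + rnorm x ^+ 2.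
Proof.
move=> s1 Dx; rewrite (rnormD_sqr dot_norm) rdotZr rdot_selfadjoint_i// mulr0 mulr0 addr0.
by rewrite (rnormZ dot_norm) rnorm_i exprMn real_normK ?num_real// s1 mul1r.
Qed.

Lemma shifted_expanding s x y : s ^+ 2 = 1 -> D x -> D y ->
  rnorm (x - y) <= rnorm (shifted s x - shifted s y).
Proof.
move=> s1 Dx Dy; rewrite -(@ler_pXn2r _ 2) ?nnegrE ?rnorm_ge0//.
have [] := shiftedD s (-1) Dx Dy; rewrite rmorphN1 !scaleN1r => Dxy <-.
by rewrite rnorm_shifted// lerDr sqr_ge0.
Qed.

(** Since [shifted s] does not shrink distances, preimages of a convergent sequence are Cauchy;
    their images under [A] then converge too, and [A] is closed because it equals its adjoint. *)
Lemma shifted_range_closed s (u : nat -> H) l : s ^+ 2 = 1 ->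
  (forall n, (shifted s @` D) (u n)) -> u @ \oo --> l -> (shifted s @` D) l.
Proof.
move=> s1 /(_ _)/cid2-/all_sig2[f Df fu] ul.
have [|x fx] := rnorm_cauchy_cvg (u := f).
  move=> e e0.
  have/cvg_rnormP ul' := ul; have {}ul' := ul' _ (divr_gt0 e0 (ltr0Sn _ 1)).
  near=> N; near=> n.
  apply: le_lt_trans (shifted_expanding s1 (Df _) (Df _)) _; rewrite !fu.
  have -> : u N - u n = (l - u n) - (l - u N) by rewrite opprB [RHS]addrC subrKA.
  apply: le_lt_trans (rnormD _ _) _; rewrite rnormN [e]splitr ltrD//.
    by near: n; exact: ul'.
  by near: N; exact: ul'.
pose w := l - s%:C%C *: ('i%C *: x).
have Afw : (A \o f) @ \oo --> w.
  rewrite (_ : A \o f = (fun n => u n - s%:C%C *: ('i%C *: f n))); last first.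
    by apply/funext => n /=; rewrite -fu /shifted addrK.
  by apply: cvgB => //; apply: cvgZl_tmp; exact: cvgZl_tmp.
have [Dx wE] : D x /\ w = A x.
  apply: selfadjoint_rdot => g Dg.
  have h1 := cvg_rdotl (y := A g) eventually_filter fx.
  have h2 := cvg_rdotl (y := g) eventually_filter Afw.
  have fE : (fun n => rdot ((A \o f) n) g) = (fun n => rdot (f n) (A g)).
    by apply/funext => n; rewrite /re_dot selfadjoint_sym.
  rewrite fE in h2; exact: (@cvg_unique _ (@Rhausdorff R) _ _ _ _ h1 h2).
by exists x => //; rewrite /shifted -wE subrK.
Unshelve. all: by end_near. Qed.

(** A vector r orthogonal to the range lies in [D] with A r = s i r. As (A r, r) is real, s |r|^2 =
    0. *)
Lemma shifted_surjective s y : s ^+ 2 = 1 -> exists2 x, D x & shifted s x = y.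
Proof.
move=> s1.
have [|||p [x Dx <-] xorth] := @hilbert_projection _ _ dot dot_norm (shifted s @` D) y.
- by exists (shifted s 0), 0 => //; exact: A_linear.1.
- move=> c _ _ [v Dv <-] [w Dw <-].
  by have [Dvw vw] := shiftedD s c Dv Dw; exists (v + c%:C%C *: w).
- by move=> u l; exact: shifted_range_closed.
exists x => //; apply/eqP; rewrite eq_sym -subr_eq0 -rnorm_eq0; apply/eqP.
set r := y - shifted s x in xorth *.
have [Dr Ar] : D r /\ s%:C%C *: ('i%C *: r) = A r.
  apply: selfadjoint_rdot => f Df.
  have : rdot r (shifted s f) = 0 by apply: xorth; exists f.
  by rewrite rdotDr rdotZr rdot_ir mulrN rdotZl => /eqP; rewrite subr_eq0 => /eqP.
have := rdot_selfadjoint_i Dr; rewrite -Ar rdotZl rdot_ii (rdotxx dot_norm).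
move=> /eqP; rewrite mulf_eq0 sqrf_eq0 => /orP[/eqP s0|/eqP//].
by move: s1; rewrite s0 expr0n => /eqP; rewrite eq_sym oner_eq0.
Qed.

End resolvent.

(** * The weak eigenvalue equation *)

Section borel_hilbert.
Context {R : realType} {H : completeNormedModType R[i]}.
Notation mu := (@lebesgue_measure R).
Implicit Types (I : set R) (a b : R).

Lemma open_continuous_measurable_norm (u : R -> H) I : open I -> {in I, continuous u} ->
  measurable_fun I (u : R -> g_sigma_algebraType (@open H)).
Proof.
move=> oI cu.
apply: (@measurability _ _ _ (g_sigma_algebraType (@open H)) I u (@open H)) => //.
move=> _ [B oB <-]; apply: open_measurable; rewrite openE => t [It But].
apply: filterI; first exact: open_nbhs_nbhs.
by apply: cu; [rewrite inE|exact: open_nbhs_nbhs].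
Qed.

Lemma continuous_comp_measurable_norm (F : H -> R) (u : R -> H) I : measurable I ->
  continuous F -> measurable_fun I (u : R -> g_sigma_algebraType (@open H)) ->
  measurable_fun I (F \o u).
Proof.
move=> mI /continuousP cF mu_; apply: (measurability _ (RGenOpens.measurableE R)).
move=> _ [_ [x [y ->] <-]]; rewrite comp_preimage; apply: mu_ => //.
by apply: sub_sigma_algebra; apply: cF; exact: interval_open.
Qed.

Lemma cvg_rnorm (T : Type) (F : set_system T) (FF : Filter F) (f : T -> H) (l : H) :
  f @ F --> l -> (fun t => rnorm (f t)) @ F --> rnorm l.
Proof.
move=> /cvg_rnormP fl; apply/cvgrPdist_lt => e e0.
apply: filterS (fl _ e0) => t; apply: le_lt_trans.
have rnormB_le (x y : H) : rnorm x - rnorm y <= rnorm (x - y).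
  by rewrite lerBlDr -[X in rnorm X <= _](subrK y) rnormD.
rewrite ler_norml rnormB_le andbT lerNl opprB.
by rewrite -(rnormN (l - f t)) opprB rnormB_le.
Qed.

Lemma rnorm_continuous : continuous (@rnorm R H).
Proof. by move=> x; exact: cvg_rnorm. Qed.

Section compact_support.
Variables (I : set R) (a b : R).
Hypothesis abI : `[a, b] `<=` I.

Let restrict_support (V : pointedType) (f : R -> V) :
  (forall t, (t <= a) || (b <= t) -> f t = point) -> (f \_ I) = (f \_ `[a, b]).
Proof.
move=> f0; apply/funext => t; rewrite !patchE.
have [tab|tab] := boolP (t \in `[a, b]%classic).
  by rewrite ifT//; apply/mem_set/abI/set_mem.
case: ifP => // _; apply: f0; move: tab; rewrite notin_setE/= in_itv/=.
by move=> /negP; rewrite negb_and -!ltNge => /orP[] /ltW ->; rewrite ?orbT.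
Qed.

Lemma integral_support (f : R -> \bar R) :
  (forall t, (t <= a) || (b <= t) -> f t = 0%E) ->
  (\int[mu]_(t in I) f t = \int[mu]_(t in `[a, b]) f t)%E.
Proof.
by move=> f0; rewrite integral_mkcond [RHS]integral_mkcond (restrict_support f0).
Qed.

Lemma Rintegral_support (f : R -> R) :
  (forall t, (t <= a) || (b <= t) -> f t = 0) ->
  \int[mu]_(t in I) f t = \int[mu]_(t in `[a, b]) f t.
Proof.
by move=> f0; rewrite Rintegral_mkcond [RHS]Rintegral_mkcond (restrict_support f0).
Qed.

Lemma L2_support (w : R -> H) : open I -> continuous w ->
  (forall t, (t <= a) || (b <= t) -> w t = 0) -> L2 I w.
Proof.
move=> oI cw w0; split.
  by apply: open_continuous_measurable_norm => // x _; exact: cw.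
rewrite /L2sqn integral_support; last first.
  by move=> t /w0 ->; rewrite normr0 expr0n.
have : mu.-integrable `[a, b] (EFin \o (fun t => rnorm (w t) ^+ 2)).
  apply: continuous_integrable; apply: continuous_subspaceT => t.
  by apply: cvgM; apply: cvg_rnorm; exact: cw.
move=> /integrableP[_]; congr (_ < _)%E; apply: eq_integral => t _.
by rewrite gee0_abs// lee_fin sqr_ge0.
Qed.

End compact_support.

Section test_functions.
Variable dot : {dot H for Num.conj}.
Hypothesis dot_norm : forall x : H, `|x| ^+ 2 = dot x x.
Local Notation rdot := (re_dot dot).
Variables (I : set R) (a b : R).
Hypotheses (oI : open I) (abI : `[a, b] `<=` I).

Lemma rdot_continuous (y : H) : continuous (fun x => rdot x y).
Proof. by move=> x; exact: cvg_rdotl. Qed.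

(** Passes from the merely measurable [u] on [I] to its continuous representative on a compact
    interval, where every integrand below is integrable by continuity. *)
Lemma Rintegral_rdot_test (u v : R -> H) (x y : H) (phi psi : R -> R) :
  measurable_fun I (u : R -> g_sigma_algebraType (@open H)) ->
  {in I, continuous v} -> ae_eq mu I u v ->
  continuous phi -> continuous psi ->
  (forall t, (t <= a) || (b <= t) -> phi t = 0) ->
  (forall t, (t <= a) || (b <= t) -> psi t = 0) ->
  \int[mu]_(t in I) (phi t * rdot (u t) x + psi t * rdot (u t) y) =
  \int[mu]_(t in `[a, b]) (phi t * rdot (v t) x + psi t * rdot (v t) y).
Proof.
move=> mu_ cv uv cphi cpsi phi0 psi0.
have mI : measurable I by exact: open_measurable.
have mF (w : R -> H) : measurable_fun I (w : R -> g_sigma_algebraType (@open H)) ->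
    measurable_fun I (fun t => (phi t * rdot (w t) x + psi t * rdot (w t) y)%:E).
  move=> mw; apply/measurable_EFinP; apply: measurable_funD; apply: measurable_funM.
  - by apply: measurable_funTS; exact: continuous_measurable_fun.
  - exact: (continuous_comp_measurable_norm mI (@rdot_continuous x) mw).
  - by apply: measurable_funTS; exact: continuous_measurable_fun.
  - exact: (continuous_comp_measurable_norm mI (@rdot_continuous y) mw).
have mv := open_continuous_measurable_norm oI cv.
transitivity (\int[mu]_(t in I) (phi t * rdot (v t) x + psi t * rdot (v t) y)).
  rewrite /Rintegral; congr fine; apply: ae_eq_integral => //; [exact: mF|exact: mF|].
  by apply: filterS uv => t /[apply] ->.
by apply: Rintegral_support => // t tab; rewrite phi0// psi0// !mul0r addr0.
Qed.

Variables (D : set H) (A : H -> H).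
Hypothesis A_linear : linear_on D A.

Lemma core_graph_test (phi : R -> R) (f : H) : smooth phi ->
  (forall t, (t <= a) || (b <= t) -> phi t = 0) -> D f ->
  core_graph D A I (fun t => (phi t)%:C%C *: f,
    fun t => (derive1 phi t)%:C%C *: ('i%C *: f) + (phi t)%:C%C *: A f).
Proof.
move=> sphi phi0 Df.
exists 1, (fun _ t => (phi t)%:C%C), (fun _ => f); split => //=.
- move=> _.
  have sub : closure [set t | (phi t)%:C%C != 0] `<=` `[a, b].
    rewrite [X in _ `<=` X](closure_id _).1; last exact: interval_closed.
    apply: closureS => t /=; rewrite in_itv/=; apply: contraNT.
    rewrite negb_and -!ltNge => tab; apply/eqP; congr (_%:C%C); apply: phi0.
    by case/orP: tab => /ltW ->; rewrite ?orbT.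
  split.
  - exact: sphi.
  - exact: (@smooth_cst _ 0).
  - apply: subclosed_compact (@segment_compact _ a b) sub; exact: closed_closure.
  - exact: subset_trans sub abI.
- by apply/funext => t; rewrite big_ord1.
- apply/funext => t; rewrite !big_ord1 (linear_onZ A_linear _ Df).2; congr (_ + _).
  rewrite scalerA mulrC -scalerA; congr (_ *: _).
  by rewrite /cderive1 /= derive1_cst.
Qed.

(** Outside the closed interval [phi] is locally zero; at [a] and [b], where it is known to vanish
    on one side only, continuity of the derivative concludes. *)
Lemma derive1_support (phi : R -> R) : smooth phi ->
  (forall t, (t <= a) || (b <= t) -> phi t = 0) ->
  forall t, (t <= a) || (b <= t) -> derive1 phi t = 0.
Proof.
move=> sphi phi0.
have phi'0 t : (t < a) || (b < t) -> derive1 phi t = 0.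
  move=> tab; rewrite derive1E -(derive_cst (0 : R) t 1); apply: near_eq_derive.
  case/orP: tab => [ta|bt]; near=> s; apply: phi0; apply/orP.
    by left; apply/ltW; near: s; exact: lt_nbhsl.
  by right; apply/ltW; near: s; exact: lt_nbhsr.
have cphi' : continuous (derive1 phi) by exact/smooth_continuous/smooth_derive1.
move=> t; rewrite !le_eqVlt => /orP[/predU1P[->|h]|/predU1P[<-|h]]; last 1 first.
- by rewrite phi'0// h orbT.
- have h1 : derive1 phi @ a^'- --> derive1 phi a by exact/cvg_at_left_filter/cphi'.
  have h2 : derive1 phi @ a^'- --> (0 : R).
    apply: cvg_near_cst; near=> s; apply: phi'0; apply/orP; left.
    by near: s; exact: nbhs_left_lt.
  exact: (@cvg_unique _ (@Rhausdorff R) _ _ _ _ h1 h2).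
- by rewrite phi'0// h.
- have h1 : derive1 phi @ b^'+ --> derive1 phi b by exact/cvg_at_right_filter/cphi'.
  have h2 : derive1 phi @ b^'+ --> (0 : R).
    apply: cvg_near_cst; near=> s; apply: phi'0; apply/orP; right.
    by near: s; exact: nbhs_right_gt.
  exact: (@cvg_unique _ (@Rhausdorff R) _ _ _ _ h1 h2).
Unshelve. all: by end_near. Qed.

Lemma L2closure_core (p : (R -> H) * (R -> H)) : core_graph D A I p ->
  L2 I p.1 -> L2 I p.2 -> Lmin D A I p.
Proof.
move=> cp L1 L2_; split=> // e e0; exists p; split=> //.
  by rewrite subrr /L2sqn integral0_eq// => t _; rewrite normr0 expr0n.
by rewrite subrr /L2sqn integral0_eq// => t _; rewrite normr0 expr0n.
Qed.

Lemma Lmax_weak (u v : R -> H) (z : R[i]) (f : H) (phi : R -> R) :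
  Lmax dot D A I (u, z *: u) -> {in I, continuous v} -> ae_eq mu I u v ->
  D f -> smooth phi -> a < b -> (forall t, (t <= a) || (b <= t) -> phi t = 0) ->
  \int[mu]_(t in `[a, b]) (derive1 phi t * rdot (v t) ('i%C *: f) +
    phi t * rdot (v t) (A f - conjc z *: f)) = 0.
Proof.
move=> [L2u _ adj] cv uv Df sphi ab phi0.
have sphi' := smooth_derive1 sphi.
have cphi : continuous phi by exact: smooth_continuous.
have cphi' : continuous (derive1 phi) by exact: smooth_continuous.
have phi'0 t : (t <= a) || (b <= t) -> derive1 phi t = 0 by exact: derive1_support.
have cC (h : R -> R) (x : H) : continuous h -> continuous (fun t => (h t)%:C%C *: x).
  move=> ch t; apply: cvgZr_tmp; apply/cvgrPdist_lt => -[e e'].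
  rewrite ltcE /= => /andP[/eqP -> e0].
  have /cvgrPdist_lt/(_ _ e0) := ch t; apply: filterS => s.
  by rewrite -rmorphB normc_def/= expr0n/= addr0 sqrtr_sqr ltcR.
have L1 : L2 I (fun t => (phi t)%:C%C *: f).
  by apply: (L2_support abI) oI (cC phi f cphi) _ => t /phi0 ->; rewrite scale0r.
have L2' : L2 I (fun t => (derive1 phi t)%:C%C *: ('i%C *: f) + (phi t)%:C%C *: A f).
  apply: (L2_support abI) oI _ _ => t; last move=> tab.
    apply: cvgD; [exact: (cC _ _ cphi')|exact: (cC _ _ cphi)].
  by rewrite phi'0// phi0// !scale0r addr0.
have := adj _ (L2closure_core (core_graph_test sphi phi0 Df) L1 L2').
move=> /(congr1 (@complex.Re R)) /=.
have -> : \int[mu]_(t in I) complex.Re (dot (u t)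
   ((derive1 phi t)%:C%C *: ('i%C *: f) + (phi t)%:C%C *: A f)) =
   \int[mu]_(t in I) (derive1 phi t * rdot (u t) ('i%C *: f) + phi t * rdot (u t) (A f)).
  by apply: eq_Rintegral => t _; rewrite -!rdotZr -rdotDr.
(* The zero term gives this integral the two-term shape of [Rintegral_rdot_test]; moving [z] to the
   second argument conjugates it. *)
have -> : \int[mu]_(t in I) complex.Re (dot ((z *: u) t) ((phi t)%:C%C *: f)) =
   \int[mu]_(t in I) (derive1 phi t * rdot (u t) 0 + phi t * rdot (u t) (conjc z *: f)).
  apply: eq_Rintegral => t _; rewrite rdot0r mulr0 add0r -rdotZcl -rdotZr.
  by [].
have mu_ := L2u.1.
rewrite (Rintegral_rdot_test _ _ mu_ cv uv)// (Rintegral_rdot_test _ _ mu_ cv uv)//.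
move=> /eqP; rewrite -subr_eq0 => /eqP Eq.
have cvab (x : H) : {within `[a, b], continuous (fun t => rdot (v t) x)}.
  apply: continuous_in_subspaceT => t /[!inE] tab.
  have cvt : {for t, continuous v} by apply: cv; rewrite inE; exact: abI.
  by apply: cvg_rdotl cvt.
have cint (x y : H) : mu.-integrable `[a, b]
    (fun t => (derive1 phi t * rdot (v t) x + phi t * rdot (v t) y)%:E).
  apply: continuous_integrable; apply: within_continuousD.
    by apply: within_continuousM => //; exact: smooth_within.
  by apply: within_continuousM => //; exact: smooth_within.
rewrite -(RintegralB _ (cint _ _) (cint _ _)) in Eq => //.
rewrite -[RHS]Eq; apply: eq_Rintegral => t _.
rewrite rdot0r mulr0 add0r rdotDr rdotNr; ring.
Qed.

End test_functions.
End borel_hilbert.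

(** * The energy of the regularised eigenfunction *)

Section energy.
Context {R : realType} {H : completeNormedModType R[i]}.
Variable dot : {dot H for Num.conj}.
Hypothesis dot_norm : forall x : H, `|x| ^+ 2 = dot x x.
Notation mu := (@lebesgue_measure R).
Local Notation rdot := (re_dot dot).

Lemma rdotZ_self (c : R[i]) (x : H) : rdot (c *: x) x = complex.Re c * rnorm x ^+ 2.
Proof.
rewrite /re_dot linearZl_LR /= -dot_norm rnormE -rmorphXn/=.
by case: c => p q /=; rewrite mulr0 subr0.
Qed.

(** Error bound for the mean value argument below. The restriction e <= 1 keeps the norm of [y + y0]
    below a constant depending on [y0] alone, so the error is linear in [e]. *)
Lemma rdot_dist_le (x x0 y y0 : H) (e : R) : e <= 1 ->
  rnorm (x0 - x) <= e -> rnorm (y0 - y) <= e ->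
  `|rdot x (y + y0) - 2 * rdot x0 y0| <= e * (2 * rnorm y0 + 1 + rnorm x0).
Proof.
move=> e1 xe ye.
have -> : rdot x (y + y0) - 2 * rdot x0 y0 =
    - rdot (x0 - x) (y + y0) - rdot x0 (y0 - y).
  by rewrite rdotDl rdotNl !rdotDr rdotNr; ring.
have yy0 : rnorm (y + y0) <= 2 * rnorm y0 + 1.
  rewrite -[y](subrK y0) -addrA; apply: le_trans (rnormD _ _) _.
  have : rnorm (y - y0) <= 1 by rewrite -rnormN opprB (le_trans ye).
  by have := rnormD y0 y0; lra.
apply: le_trans (ler_normB _ _) _; rewrite normrN [leRHS]mulrDr; apply: lerD.
  apply: le_trans (rdot_CauchySchwarz dot_norm _ _) _.
  by apply: ler_pM => //; exact: rnorm_ge0.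
apply: le_trans (rdot_CauchySchwarz dot_norm _ _) _.
by rewrite mulrC ler_wpM2r// rnorm_ge0.
Qed.

(* For fixed [s] and [t] the mean value theorem applies to the scalar function
   [rdot (y _) (y s + y t)], whose increment between [t] and [s] is that of the
   squared norm; no strong derivative of [y] is needed. *)
Lemma is_derive_rnorm_sqr (I : set R) (y dy : R -> H) : open I ->
  {in I, continuous y} -> {in I, continuous dy} ->
  (forall g t, I t -> is_derive t 1 (fun s => rdot (y s) g) (rdot (dy t) g)) ->
  forall t, I t -> is_derive t 1 (fun s => rnorm (y s) ^+ 2) (2 * rdot (dy t) (y t)).
Proof.
move=> oI cy cdy dydt t It.
set l := 2 * _; pose N s := rnorm (y s) ^+ 2.
suff cv : h^-1 *: ((N \o shift t) (h *: 1) - N t) @[h --> 0^'] --> l.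
  apply: DeriveDef; first by apply/cvg_ex; exists l.
  exact: cvg_lim.
apply/cvgrPdist_le => e e0.
(* The constant of [rdot_dist_le] at the limits [dy t] and [y t]. *)
pose K := 2 * rnorm (y t) + 1 + rnorm (dy t).
have K0 : 0 < K by rewrite /K ltr_wpDr ?rnorm_ge0// ltr_wpDl// mulr_ge0// rnorm_ge0.
pose d := Num.min 1 (e / K).
have d0 : 0 < d by rewrite /d lt_min ltr01/= divr_gt0.
have d1 : d <= 1 by rewrite /d ge_min lexx.
have dK : d * K <= e by rewrite -ler_pdivlMr// /d ge_min lexx orbT.
have tI : t \in I by rewrite inE.
have : \forall s \near t, [/\ I s, rnorm (y t - y s) < d & rnorm (dy t - dy s) < d].
  near=> s; split; near: s.
  - exact: open_nbhs_nbhs.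
  - by have /cvg_rnormP := cy _ tI; apply.
  - by have /cvg_rnormP := cdy _ tI; apply.
move=> /nbhs_ballP[r /= r0 tr].
near=> h.
have h0 : h != 0 by near: h; exact: nbhs_dnbhs_neq.
have hr : `|h| < r by near: h; exact: dnbhs0_lt.
rewrite /= /GRing.scale/= mulr1.
pose g := y (h + t) + y t.
have NE : N (h + t) - N t = rdot (y (h + t)) g - rdot (y t) g.
  by rewrite /N -!(rdotxx dot_norm) /g !rdotDr (rdotC _ (y t) (y (h + t))); ring.
have [c tc cE] : exists2 c, ball t r c & rdot (y (h + t)) g - rdot (y t) g = rdot (dy c) g * h.
  have mvt p q : p < q -> (forall x, p <= x <= q -> ball t r x) ->
      exists2 c, ball t r c & rdot (y q) g - rdot (y p) g = rdot (dy c) g * (q - p).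
    move=> pq bpq.
    have [x xpq||c cpq ->] := @MVT_segment _ (fun s => rdot (y s) g) (fun s => rdot (dy s) g) p q (ltW pq).
    - apply: dydt; suff /tr[] : ball t r x by []; apply: bpq.
      by move: xpq; rewrite in_itv/= => /andP[/ltW -> /ltW ->].
    - apply: continuous_in_subspaceT => x /[!inE]/= xpq.
      have cyx : {for x, continuous y}.
        by apply: cy; rewrite inE; have /tr[] : ball t r x by exact: bpq.
      by apply: cvg_rdotl cyx.
    - by exists c => //; apply: bpq; move: cpq; rewrite in_itv.
  case: (ltgtP h 0) => [hn|hp|/eqP]; last by rewrite (negbTE h0).
    have [||c tc cE] := mvt (h + t) t; first by lra.
      by move=> x xh; rewrite /ball/= ltr_distlC; move: hr; rewrite ltr_norml; lra.
    by exists c => //; lra.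
  have [||c tc cE] := mvt t (h + t); first by lra.
    by move=> x xh; rewrite /ball/= ltr_distlC; move: hr; rewrite ltr_norml; lra.
  by exists c => //; lra.
rewrite NE cE mulrCA mulVf// mulr1 distrC; apply: le_trans dK.
have [_ _ dyc] := tr _ tc.
have [|_ yh _] := tr (h + t).
  by rewrite /ball/= ltr_distlC; move: hr; rewrite ltr_norml; lra.
by apply: rdot_dist_le => //; exact: ltW.
Unshelve. all: by end_near. Qed.

Section eigenfunction.
Variables (D : set H) (A : H -> H).
Hypotheses (A_linear : linear_on D A) (A_selfadjoint : selfadjoint dot D A).

Lemma resolvent_exists (s : R) : s ^+ 2 = 1 ->
  exists S : H -> H, forall x, D (S x) /\ shifted A s (S x) = x.
Proof.
move=> s1; have /choice[S SE] x : exists y, D y /\ shifted A s y = x.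
  by have [y Dy <-] := shifted_surjective dot_norm A_linear A_selfadjoint x s1; exists y.
by exists S.
Qed.

Section resolvents.
(** [S] is (A - i)^-1 and [T] is (A + i)^-1. They are mere choices of preimages; homogeneity and the
    Lipschitz bound of [S] come from the fact that [shifted] does not shrink distances. *)
Variables S T : H -> H.
Hypotheses (SE : forall x, D (S x) /\ shifted A (-1) (S x) = x)
  (TE : forall x, D (T x) /\ shifted A 1 (T x) = x).

Let sqN1 : (-1 : R) ^+ 2 = 1. Proof. by rewrite sqrrN expr1n. Qed.

Let SAE x : x = A (S x) - 'i%C *: S x.
Proof. by have [_ {1}<-] := SE x; rewrite /shifted rmorphN1 scaleN1r. Qed.

Let TAE x : x = A (T x) + 'i%C *: T x.
Proof. by have [_ {1}<-] := TE x; rewrite /shifted rmorph1 scale1r. Qed.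

Lemma resolvent_adjoint x y : rdot (S x) y = rdot x (T y).
Proof.
rewrite [in LHS](TAE y) [in RHS](SAE x) rdotDr rdotDl rdotNl rdot_ir; congr (_ + _).
by rewrite /re_dot (selfadjoint_sym A_selfadjoint (SE x).1 (TE y).1).
Qed.

Lemma resolvent_lipschitz x y : rnorm (S x - S y) <= rnorm (x - y).
Proof.
rewrite -{2}(SE x).2 -{2}(SE y).2.
exact (shifted_expanding dot_norm A_linear A_selfadjoint sqN1 (SE x).1 (SE y).1).
Qed.

Lemma resolventZ (c : R[i]) x : S (c *: x) = c *: S x.
Proof.
apply/eqP; rewrite -subr_eq0 -rnorm_eq0 eq_le rnorm_ge0 andbT.
have [Dc Ac] := linear_onZ A_linear c (SE x).1.
apply: le_trans (shifted_expanding dot_norm A_linear A_selfadjoint sqN1 (SE _).1 Dc) _.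
have -> : shifted A (-1) (c *: S x) = c *: x.
  by rewrite /shifted Ac rmorphN1 scaleN1r scalerA mulrC -scalerA -scalerBr -SAE.
by rewrite (SE _).2 subrr /rnorm normr0.
Qed.

Lemma resolvent0 : S 0 = 0.
Proof. by have := resolventZ 0 0; rewrite !scale0r. Qed.

Lemma resolvent_eq0 x : S x = 0 -> x = 0.
Proof. by move=> Sx; rewrite (SAE x) Sx (linear_on0 A_linear) scaler0 subr0. Qed.

Lemma cvg_resolvent (U : Type) (F : set_system U) (FF : Filter F) (f : U -> H) (l : H) :
  f @ F --> l -> (fun t => S (f t)) @ F --> S l.
Proof.
move=> /cvg_rnormP fl; apply/cvg_rnormP => e e0.
by apply: filterS (fl _ e0) => t; apply: le_lt_trans; exact: resolvent_lipschitz.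
Qed.

Variables (I : set R) (u v : R -> H) (z : R[i]).
Hypotheses (oI : open I) (Lu : Lmax dot D A I (u, z *: u))
  (cv : {in I, continuous v}) (uv : ae_eq mu I u v).

(** This is i A S x - i z S x with A S x = x + i S x substituted, a form continuous in [x] although
    [A] need not be. *)
Let dS x := 'i%C *: x - S x - ('i%C * z) *: S x.

Lemma is_derive_rdot_resolvent g t : I t ->
  is_derive t 1 (fun s => rdot (S (v s)) g) (rdot (dS (v t)) g).
Proof.
(* The weak equation pairs phi' with i f, so f = - i T g is the test vector that makes i f equal to
   [T g]. *)
have [Df Af] := linear_onZ A_linear (- 'i%C) (TE g).1.
have fE : 'i%C *: (- 'i%C *: T g) = T g.
  by rewrite scalerA mulrN -expr2 sqr_i opprK scale1r.
have kE x : rdot (dS x) g = rdot x (A (- 'i%C *: T g) - conjc z *: (- 'i%C *: T g)).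
  have -> : A (- 'i%C *: T g) = - ('i%C *: g) - T g.
    have -> : 'i%C *: g = 'i%C *: A (T g) - T g.
      by rewrite {1}(TAE g) scalerDr scalerA -expr2 sqr_i scaleN1r.
    by rewrite Af scaleNr opprD opprK addrK.
  rewrite !rdotDr !rdotNr rdot_ir opprK -resolvent_adjoint scalerA.
  rewrite /dS !rdotDl !rdotNl -resolventZ; congr (_ - _).
  rewrite resolvent_adjoint rdotZcl; congr (re_dot _ _ (_ *: _)); rewrite rmorphM mulrC; congr (_ * _).
  by apply/eqP; rewrite eq_complex/= oppr0 !eqxx.
move=> It; rewrite kE.
have -> : (fun s => rdot (S (v s)) g) = (fun s => rdot (v s) ('i%C *: (- 'i%C *: T g))).
  by apply/funext => s; rewrite fE resolvent_adjoint.
have crdot (x : H) : {in I, continuous (fun s => rdot (v s) x)}.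
  by move=> s sI; have cvs := cv sI; apply: cvg_rdotl cvs.
apply: (weak_derivative_is_derive oI (crdot _) (crdot _)) It.
move=> phi a b ab abI sphi phi0.
exact: (Lmax_weak dot_norm oI abI A_linear Lu cv uv).
Qed.

Lemma rdot_dS x : rdot (dS x) (S x) = complex.Im z * rnorm (S x) ^+ 2.
Proof.
rewrite /dS {1}(SAE x) scalerBr scalerA -expr2 sqr_i scaleN1r opprK addrK.
rewrite rdotDl rdotNl rdotZ_self -[rdot ('i%C *: _) _]opprK -rdot_ir.
rewrite (rdot_selfadjoint_i A_selfadjoint (SE x).1) oppr0 add0r.
by case: z => p q /=; ring.
Qed.

Lemma is_derive_energy t : I t ->
  is_derive t 1 (fun s => rnorm (S (v s)) ^+ 2)
    (2 * complex.Im z * rnorm (S (v t)) ^+ 2).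
Proof.
move=> It; rewrite -mulrA -rdot_dS.
apply: (is_derive_rnorm_sqr oI (dy := fun s => dS (v s))) It.
- by move=> s sI; have cvs := cv sI; apply: cvg_resolvent cvs.
- move=> s sI; have cvs := cv sI; apply: cvgB; last first.
    by apply: cvgZl_tmp; apply: cvg_resolvent cvs.
  by apply: cvgB; [exact: cvgZl_tmp|apply: cvg_resolvent cvs].
- by move=> g s; exact: is_derive_rdot_resolvent.
Qed.

End resolvents.
End eigenfunction.

End energy.

(** * Conservation of the energy *)

Section eigenfunction_decay.
Context {R : realType} {H : completeNormedModType R[i]}.
Variable dot : {dot H for Num.conj}.
Hypothesis dot_norm : forall x : H, `|x| ^+ 2 = dot x x.
Notation mu := (@lebesgue_measure R).

(** A positive constant has infinite integral over a set of infinite measure. *)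
Lemma L2_lower_bound_le0 (I : set R) (u v : R -> H) (c : R) : open I ->
  mu I = +oo%E -> L2 I u -> {in I, continuous v} -> ae_eq mu I u v ->
  (forall t, I t -> c <= rnorm (v t) ^+ 2) -> c <= 0.
Proof.
move=> oI muI [mu_ fin_u] cv uv cle; rewrite leNgt; apply/negP => c0.
have mI : measurable I by exact: open_measurable.
have mN (w : R -> H) : measurable_fun I (w : R -> g_sigma_algebraType (@open H)) ->
    measurable_fun I (fun t => (rnorm (w t) ^+ 2)%:E).
  move=> mw; apply/measurable_EFinP; apply: measurable_funX.
  exact: (continuous_comp_measurable_norm mI (@rnorm_continuous _ _) mw).
have mv := open_continuous_measurable_norm oI cv.
have uvE : L2sqn I u = (\int[mu]_(t in I) (rnorm (v t) ^+ 2)%:E)%E.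
  apply: ge0_ae_eq_integral => //.
  - exact: mN.
  - exact: mN.
  - by move=> t _; rewrite lee_fin sqr_ge0.
  - by move=> t _; rewrite lee_fin sqr_ge0.
  - by apply: filterS uv => t /[apply] ->.
move: fin_u; rewrite uvE; apply/negP; rewrite -leNgt.
apply: (@le_trans _ _ (\int[mu]_(t in I) (cst c%:E) t)%E).
  by rewrite integral_cst// [X in (_ * X)%E](_ : _ = +oo%E)// gt0_muley// lte_fin.
apply: ge0_le_integral => //.
- by move=> t _; rewrite lee_fin ltW.
- exact: mN.
Qed.

Variables (D : set H) (A : H -> H).
Hypotheses (A_linear : linear_on D A) (A_selfadjoint : selfadjoint dot D A).
(** Both half-lines are treated at once: [I] is the open one, [J] includes the endpoint, and only
    openness and order convexity enter. *)
Variables (I J : set R) (u v : R -> H) (z : R[i]).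
Hypotheses (oI : open I) (IJ : I `<=` J).
Hypotheses (J_itv : forall s t, J s -> J t -> `[s, t] `<=` J)
  (JI : forall s t, J s -> J t -> `]s, t[ `<=` I).
Hypotheses (Lu : Lmax dot D A I (u, z *: u)) (rep : continuous_rep I J u v).

Lemma continuous_rep_in : {in I, continuous v}.
Proof.
by rewrite -continuous_open_subspace//; exact: continuous_subspaceW IJ rep.1.
Qed.

(** The integrating factor exp(- k t) turns the energy into [M], which has zero derivative on [I]
    and is continuous on [J]. The mean value theorem needs the derivative only in the open interval,
    so the endpoint of [J] is included. *)
Lemma energy_constant (S T : H -> H) :
  (forall x, D (S x) /\ shifted A (-1) (S x) = x) ->
  (forall x, D (T x) /\ shifted A 1 (T x) = x) ->
  forall s t, J s -> J t ->
  rnorm (S (v t)) ^+ 2 = expR (2 * complex.Im z * (t - s)) * rnorm (S (v s)) ^+ 2.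
Proof.
move=> SE TE.
pose k := 2 * complex.Im z; pose N t := rnorm (S (v t)) ^+ 2.
pose M t := N t * expR (- (k * t)).
have dM t : I t -> is_derive t 1 M 0.
  move=> It.
  have dN := is_derive_energy dot_norm A_linear A_selfadjoint SE TE oI Lu continuous_rep_in rep.2 It.
  have dk : is_derive t 1 (fun t => - (k * t)) (- k).
    have := is_deriveN (is_deriveZ k (is_derive_id t 1)).
    by rewrite /GRing.scale/= mulr1.
  have dE := @is_derive1_comp _ expR (fun t => - (k * t)) _ _ _ (is_derive_expR _) dk.
  have := is_deriveM dN dE; rewrite /GRing.scale/=.
  set d := (X in is_derive _ _ _ X); suff -> : d = 0 by [].
  rewrite /d /k; ring.
have cM : {within J, continuous M}.
  apply/subspace_continuousP => t Jt.
  have /subspace_continuousP/(_ t Jt) cv := rep.1.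
  have cS := cvg_resolvent dot_norm A_linear A_selfadjoint SE _ cv.
  apply: cvgM; first by apply: cvgM; apply: cvg_rnorm; exact: cS.
  have ck : continuous (fun t : R => expR (- (k * t))).
    move=> x; apply: (@continuous_comp _ _ _ (fun t => - (k * t)) expR).
      by apply: continuousN; apply: mulrl_continuous.
    exact: continuous_expR.
  by apply: cvg_within_filter; exact: ck.
have Mst s t : J s -> J t -> s <= t -> M s = M t.
  move=> Js Jt st.
  have [x xst||c _] := @MVT_segment _ M (fun=> 0) s t st.
  - by apply: dM; exact: (JI Js Jt).
  - exact: continuous_subspaceW (J_itv Js Jt) cM.
  - by rewrite mul0r => /eqP; rewrite subr_eq0 => /eqP.
have MM s t : J s -> J t -> M s = M t.
  by move=> Js Jt; case/orP: (le_total s t) => st; [exact: Mst|rewrite (Mst t s)].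
have NM t : N t = M t * expR (k * t) by rewrite /M -mulrA -expRD addNr expR0 mulr1.
move=> s t Js Jt; rewrite -/(N t) -/(N s) NM -(MM s t Js Jt) /M -mulrA -expRD mulrC.
by congr (expR _ * _); rewrite /k; ring.
Qed.

Lemma eigenfunction_eq0 s t : J s -> J t -> v s = 0 -> v t = 0.
Proof.
have sqN1 : (-1 : R) ^+ 2 = 1 by rewrite sqrrN expr1n.
have [S SE] := resolvent_exists dot_norm A_linear A_selfadjoint sqN1.
have [T TE] := resolvent_exists dot_norm A_linear A_selfadjoint (expr1n R 2).
move=> Js Jt vs0; have := energy_constant SE TE Js Jt.
rewrite vs0 (resolvent0 dot_norm A_linear A_selfadjoint SE) /rnorm normr0 expr0n mulr0.
move=> /eqP; rewrite sqrf_eq0 rnorm_eq0 => /eqP.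
exact: (resolvent_eq0 A_linear SE).
Qed.

(** Under the sign condition the exponential factor is at least 1. As [S] does not increase norms,
    the energy at [s] is a lower bound for |v|^2 on all of [I], hence is 0. *)
Lemma eigenfunction_endpoint_eq0 s : J s -> mu I = +oo%E ->
  (forall t, I t -> 0 <= complex.Im z * (t - s)) -> v s = 0.
Proof.
have sqN1 : (-1 : R) ^+ 2 = 1 by rewrite sqrrN expr1n.
have [S SE] := resolvent_exists dot_norm A_linear A_selfadjoint sqN1.
have [T TE] := resolvent_exists dot_norm A_linear A_selfadjoint (expr1n R 2).
move=> Js muI zt; apply: (resolvent_eq0 A_linear SE); apply/eqP; rewrite -rnorm_eq0 -sqrf_eq0.
rewrite eq_le sqr_ge0 andbT.
have [L2u _ _] := Lu.
apply: (L2_lower_bound_le0 oI muI L2u continuous_rep_in rep.2) => t It.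
apply: (@le_trans _ _ (rnorm (S (v t)) ^+ 2)).
  rewrite (energy_constant SE TE Js (IJ It)) ler_peMl ?sqr_ge0//.
  by rewrite -expR0 ler_expR -mulrA mulr_ge0// zt.
rewrite lerXn2r ?nnegrE ?rnorm_ge0//.
have := resolvent_lipschitz dot_norm A_linear A_selfadjoint SE (v t) 0.
by rewrite (resolvent0 dot_norm A_linear A_selfadjoint SE) !subr0.
Qed.

End eigenfunction_decay.

(** * Emptiness of the point spectrum *)

Theorem theorem3p1 (R : realType) (H : completeNormedModType R[i])
  (dot : {dot H for Num.conj})
  (dot_norm : forall x : H, `|x| ^+ 2 = dot x x)
  (H_separable : exists2 S : set H, countable S & dense S)
  (H_neq0 : exists x : H, x != 0)
  (a b : R) (ltab : a < b)
  (D : set H) (A : H -> H)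
  (A_linear : linear_on D A) (A_selfadjoint : selfadjoint dot D A)
  (W : {linear H -> H}) (W_unitary : unitary dot W) :
  point_spectrum (L2null a b) (L_W dot D A a b W) = set0.
Proof.
apply/seteqP; split=> // z [[u1 u2] [nonnull [[L1 L2]]]] [v1 [v2 [r1 r2 bc]]].
apply: nonnull.
have W0 x : W x = 0 -> x = 0.
  move=> Wx0; have := W_unitary.1 x x; rewrite Wx0 linear0l -dot_norm.
  by move=> /esym/eqP; rewrite sqrf_eq0 normr_eq0 => /eqP.
have IJ1 : `]-oo, a[ `<=` `]-oo, a] by move=> t /=; rewrite !in_itv/=; exact: ltW.
have IJ2 : `]b, +oo[ `<=` `[b, +oo[ by move=> t /=; rewrite !in_itv/= !andbT; exact: ltW.
have Ja : `]-oo, a]%classic a by rewrite /= in_itv/= lexx.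
have Jb : `[b, +oo[%classic b by rewrite /= in_itv/= lexx.
have J1_itv s t : `]-oo, a]%classic s -> `]-oo, a]%classic t -> `[s, t] `<=` `]-oo, a].
  by rewrite /= !in_itv/= => sa ta x /=; rewrite !in_itv/= => /andP[_ /le_trans]; apply.
have J2_itv s t : `[b, +oo[%classic s -> `[b, +oo[%classic t -> `[s, t] `<=` `[b, +oo[.
  by rewrite /= !in_itv/= !andbT => bs bt x /=; rewrite !in_itv/= andbT => /andP[/(le_trans bs)].
have JI1 s t : `]-oo, a]%classic s -> `]-oo, a]%classic t -> `]s, t[ `<=` `]-oo, a[.
  by rewrite /= !in_itv/= => sa ta x /=; rewrite !in_itv/= => /andP[_ /lt_le_trans]; apply.
have JI2 s t : `[b, +oo[%classic s -> `[b, +oo[%classic t -> `]s, t[ `<=` `]b, +oo[.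
  by rewrite /= !in_itv/= !andbT => bs bt x /=; rewrite !in_itv/= andbT => /andP[/(le_lt_trans bs)].
have oI1 : open (`]-oo, a[%classic : set R) by exact: interval_open.
have oI2 : open (`]b, +oo[%classic : set R) by exact: interval_open.
have [v1a v2b] : v1 a = 0 /\ v2 b = 0.
  (* For real z neither half-line allows growth or decay, and the left one is taken. From [a] to [b]
     the zero passes by linearity of [W], from [b] to [a] by its injectivity. *)
  have [z0|z0] := leP (complex.Im z) 0.
    suff v1a : v1 a = 0 by rewrite bc v1a linear0.
    apply: (eigenfunction_endpoint_eq0 dot_norm A_linear A_selfadjoint oI1 IJ1 J1_itv JI1 L1 r1 Ja).
      by rewrite lebesgue_measure_itv/= ltNyr.
    by move=> t /=; rewrite in_itv/= => ta; rewrite mulr_le0// subr_le0 ltW.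
  suff v2b : v2 b = 0 by rewrite v2b; split=> //; apply: W0; rewrite -bc.
  apply: (eigenfunction_endpoint_eq0 dot_norm A_linear A_selfadjoint oI2 IJ2 J2_itv JI2 L2 r2 Jb).
    by rewrite lebesgue_measure_itv/= ltry.
  by move=> t /=; rewrite in_itv/= andbT => bt; rewrite mulr_ge0 ?(ltW z0)// subr_ge0 ltW.
split; [apply: filterS r1.2 => t ut It|apply: filterS r2.2 => t ut It]; rewrite ut//.
- exact: (eigenfunction_eq0 dot_norm A_linear A_selfadjoint oI1 IJ1 J1_itv JI1 L1 r1 Ja (IJ1 _ It) v1a).
- exact: (eigenfunction_eq0 dot_norm A_linear A_selfadjoint oI2 IJ2 J2_itv JI2 L2 r2 Jb (IJ2 _ It) v2b).
Qed.
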